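(* Let $\mathcal{H},\mathcal{H}'$ be Hilbert spaces, let $\Lambda_1,\dots,\Lambda_n$ be countable sets, let $\{\phi^i_\lambda\}_{\lambda\in\Lambda_i}$ be a frame in $\mathcal{H}$ for $i=1,\dots,n$, with frame operators $F_i:\mathcal{H}\to l_2^i$ and adjoints $F_i^*:l_2^i\to\mathcal{H}$, let $A:\mathcal{H}\to\mathcal{H}'$ be a bounded linear operator, and let $K_A:(l_2)^n\to\mathcal{H}'$, $K_A(v^1,\dots,v^n)=\sum_{i=1}^nA(F_i^*(v^i))$, normalized so that $\|K_A\|<1$. Let $1\le p_i\le2$ and $w_i>0$ for $i=1,\dots,n$, and assume that either there exists $j$ such that $p_j>1$, or $N(K_A)=\{0\}$. For $\alpha\in\mathbb{R}^n$ and $g\in\mathcal{H}'$ let $f^*_{\alpha,g}$ be the minimizer of the functional $$\Phi_{\alpha;g}(f)=\|g-K_A(f)\|^2_{\mathcal{H}'}+\alpha\cdot|\!|\!|f|\!|\!|,\qquad f\in(l_2)^n.$$ Let $f_0\in(l_2)^n$, and let $\{g_t\}_{t=1}^{\infty}$ be a sequence in $\mathcal{H}'$ such that $\|g_t-K_Af_0\|\le\epsilon_t$, where $\{\epsilon_t\}_{t=1}^\infty$ is a sequence of strictly positive numbers converging to zero as $t\to\infty$. Let $\alpha(\epsilon_t)=(\alpha_1(\epsilon_t),\dots,\alpha_n(\epsilon_t))$ be such that for every $i,j=1,\dots,n$ $$\lim_{t\to\infty}\alpha_i(\epsilon_t)=0,\qquad\lim_{t\to\infty}\frac{\epsilon_t^2}{\alpha_i(\epsilon_t)}=0,\qquad\lim_{t\to\infty}\frac{\alpha_i(\epsilon_t)}{\alpha_j(\epsilon_t)}=1.$$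 Then $$\|f^*_{\alpha(\epsilon_t),g_t}-f^\dagger\|\to0\quad\text{as }t\to\infty,$$ where $f^\dagger$ is the unique minimal element with regard to $\mathbf{1}\cdot|\!|\!|\cdot|\!|\!|$ in $S=N(K_A)+f_0=\{f\in(l_2)^n: K_A(f)=K_A(f_0)\}$.
   Context: $l_2^i=\{\{a_\lambda\}_{\lambda\in\Lambda_i}: a_\lambda\in\mathbb{C},\ \sum_{\lambda\in\Lambda_i}|a_\lambda|^2<\infty\}$ with its usual inner product, and $(l_2)^n=l_2^1\times\dots\times l_2^n$ with inner product $\langle f,h\rangle=\sum_{i=1}^n\langle f^i,h^i\rangle_{l_2^i}$ for $f=(f^1,\dots,f^n)$, $h=(h^1,\dots,h^n)$. The frame operator of the frame $\{\phi^i_\lambda\}_{\lambda\in\Lambda_i}$ is $F_i:\mathcal{H}\to l_2^i$, $F_i f=\{\langle f,\phi^i_\lambda\rangle\}_{\lambda\in\Lambda_i}$. For $f=(f^1,\dots,f^n)\in(l_2)^n$ with $f^i=\{f^i_\lambda\}_{\lambda\in\Lambda_i}$: $|f^i|_{p_i,w_i}=\sum_{\lambda\in\Lambda_i}w_i|f^i_\lambda|^{p_i}$, $|\!|\!|f|\!|\!|=(|f^1|_{p_1,w_1},\dots,|f^n|_{p_n,w_n})$, $\alpha\cdot|\!|\!|f|\!|\!|=\sum_{i=1}^n\alpha_i|f^i|_{p_i,w_i}$, and with $\mathbf{1}=(1,\dots,1)$, $\mathbf{1}\cdot|\!|\!|f|\!|\!|=\sum_{i=1}^n|f^i|_{p_i,w_i}$.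 $N(K_A)$ is the null space of $K_A$. ''Minimal element with regard to $\mathbf{1}\cdot|\!|\!|\cdot|\!|\!|$ in $S$'' means an element of $S$ at which this functional attains its minimum over $S$.
   Formalization: Existence and uniqueness of the minimal element f† in S, with finite minimum value, are assumed: they do not follow from ''some p_j > 1'' (with p_1=1, p_2=2 the minimizers of |a|+|b|+|c|^2 on a+b+c=10 are not unique). Minimizers f* are taken as given. *)

(* Defs.v *)
From HB Require Import structures.
From mathcomp Require Import all_boot all_order all_algebra.
From mathcomp Require Import sesquilinear complex.
From mathcomp Require Import all_classical all_reals all_analysis.
From mathcomp.analysis.showcase Require summability.
From mathcomp Require Import ring.

Set Implicit Arguments.
Unset Strict Implicit.
Unset Printing Implicit Defensive.

Import Order.TTheory GRing.Theory Num.Theory Num.Def.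
Import numFieldNormedType.Exports.

Local Open Scope classical_set_scope.
Local Open Scope ring_scope.

(* Complex Hilbert spaces: complete normed spaces over R[i] whose norm comes
   from an inner product, linear in its first argument and conjugate-linear in
   the second. *)
HB.mixin Record isHilbert (R : realType) (H : Type)
    of CompleteNormedModule R[i] H := {
  inner : {dot H for (@conjC R[i])} ;
  inner_norm : forall x : H, inner x x = `|x| ^+ 2
}.

#[short(type="hilbertType")]
HB.structure Definition Hilbert (R : realType) :=
  {H of isHilbert R H & CompleteNormedModule R[i] H}.
Arguments inner {R s}.

(* The norm `|x| over R[i] is a nonnegative real number living in R[i]; rnorm
   and cmod are the same quantities in R. *)
Definition rnorm (R : realType) (V : normedModType R[i]) (x : V) : R :=
  complex.Re `|x|.

Definition cmod (R : realType) (z : R[i]) : R := complex.Re `|z|.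

Definition bounded_operator (R : realType) (H H' : hilbertType R)
    (A : H -> H') : Prop :=
  exists M : R, forall x : H, rnorm (A x) <= M * rnorm x.

Section l2.
Variables (R : realType) (L : countType).

Definition sqsum (a : L -> R[i]) : \bar R :=
  \esum_(l in [set: L]) ((cmod (a l)) ^+ 2)%:E.

Definition l2_pred : {pred (L -> R[i])} := mem [set a | (sqsum a < +oo)%E].

Lemma cmod_ge0 (z : R[i]) : 0 <= cmod z.
Proof. by rewrite /cmod normc_def /= sqrtr_ge0. Qed.

Lemma cmodE (z : R[i]) : (cmod z)%:C%C = `|z|.
Proof. by rewrite /cmod normc_def. Qed.

Lemma cmodM (z y : R[i]) : cmod (z * y) = cmod z * cmod y.
Proof. by apply: complexI; rewrite cmodE normrM rmorphM/= !cmodE. Qed.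

Lemma cmodD (z y : R[i]) : cmod (z + y) <= cmod z + cmod y.
Proof. by rewrite -lecR rmorphD /= !cmodE ler_normD. Qed.

Lemma l2_submod_closed : submod_closed l2_pred.
Proof.
split.
  rewrite inE /= /sqsum esum1 ?ltry// => l _.
  by rewrite /cmod normr0 expr0n.
move=> k a b; rewrite !inE /= => ha hb.
pose c := 2 * cmod k ^+ 2.
have c0 : 0 <= c by rewrite mulr_ge0// sqr_ge0.
have scale d (f : L -> R[i]) : 0 <= d -> (sqsum f < +oo)%E ->
    (\esum_(l in [set: L]) (d * cmod (f l) ^+ 2)%:E < +oo)%E.
  move=> d0 hf; apply: (@le_lt_trans _ _ (d%:E * sqsum f)%E); last first.
    have f0 : (0 <= sqsum f)%E.
      by apply: esum_ge0 => l _; rewrite lee_fin sqr_ge0.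
    by rewrite -(@fineK _ (sqsum f)) ?ge0_fin_numE// -EFinM ltry.
  apply: ge_ereal_sup => _ [F [finF _] <-].
  rewrite (_ : (\sum_(x \in F) _)%E =
               (d%:E * \sum_(x \in F) (cmod (f x) ^+ 2)%:E)%E).
    rewrite lee_wpmul2l ?lee_fin// /sqsum; apply: ereal_sup_ubound.
    by exists F.
  rewrite ge0_mule_fsumr//.
  by move=> l; rewrite lee_fin sqr_ge0.
apply: (@le_lt_trans _ _ (\esum_(l in [set: L])
    ((c * cmod (a l) ^+ 2)%:E + (2 * cmod (b l) ^+ 2)%:E))%E).
  apply: le_esum => l _; rewrite -EFinD lee_fin.
  have : cmod (k * a l + b l) <= cmod k * cmod (a l) + cmod (b l).
    by rewrite -cmodM cmodD.
  move=> h; apply: (@le_trans _ _ ((cmod k * cmod (a l) + cmod (b l)) ^+ 2)).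
    rewrite ler_sqr ?nnegrE ?cmod_ge0//.
    by rewrite addr_ge0 ?mulr_ge0 ?cmod_ge0.
  rewrite -subr_ge0 /c.
  rewrite (_ : _ - _ = (cmod k * cmod (a l) - cmod (b l)) ^+ 2) ?sqr_ge0//.
  by ring.
rewrite esumD; first by rewrite lte_add_pinfty// scale.
  by move=> l _; rewrite lee_fin mulr_ge0 ?sqr_ge0.
by move=> l _; rewrite lee_fin mulr_ge0 ?sqr_ge0.
Qed.

HB.instance Definition _ :=
  GRing.isSubmodClosed.Build R[i] (L -> R[i]) l2_pred l2_submod_closed.

Record l2 := L2 { l2_val :> L -> R[i] ; l2P : l2_val \in l2_pred }.

HB.instance Definition _ := [isSub for l2_val].
HB.instance Definition _ := [Choice of l2 by <:].
HB.instance Definition _ := [SubChoice_isSubLmodule of l2 by <:].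

(* summability.sum is the unconditional sum: the limit of the finite partial
   sums along the filter of finite subsets of L. *)
Definition l2_inner (a b : l2) : R[i] :=
  summability.sum (fun l => a l * (b l)^* : R[i]^o).

Definition is_frame (H : hilbertType R) (phi : L -> H) : Prop :=
  exists a b : R, [/\ 0 < a, 0 < b & forall f : H,
    ((a * rnorm f ^+ 2)%:E <= sqsum (fun l => inner f (phi l)))%E /\
    (sqsum (fun l => inner f (phi l)) <= (b * rnorm f ^+ 2)%:E)%E].

Lemma frame_l2 (H : hilbertType R) (phi : L -> H) (hphi : is_frame phi)
  (f : H) : (fun l => inner f (phi l)) \in l2_pred.
Proof.
rewrite inE /=; case: hphi => a [b [_ _ /(_ f)[_ h]]].
exact: le_lt_trans h (ltry _).
Qed.

Definition frame_operator (H : hilbertType R) (phi : L -> H)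
  (hphi : is_frame phi) (f : H) : l2 := L2 (frame_l2 hphi f).

Definition is_adjoint (H : hilbertType R) (F : H -> l2) (Fs : l2 -> H) : Prop :=
  forall (f : H) (v : l2), l2_inner (F f) v = inner f (Fs v).

(* The sum is extended-real: for p < 2 it may be infinite on l2. *)
Definition wpsum (p w : R) (a : l2) : \bar R :=
  \esum_(l in [set: L]) (w * (cmod (a l) `^ p))%:E.

End l2.

Section l2n.
Variables (R : realType) (n : nat) (L : 'I_n -> countType).

Definition l2n : Type := forall i : 'I_n, l2 R (L i).

(* The norm induced by the inner product of (l2)^n, written out:
   <f, f> is the sum over i and l of |f^i_l|^2. *)
Definition l2n_norm (f : l2n) : R :=
  Num.sqrt (\sum_(i < n) fine (sqsum (f i))).

Definition l2n_zero : l2n := fun i => 0.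
Definition l2n_sub (f h : l2n) : l2n := fun i => f i - h i.

Definition opnorm (H' : hilbertType R) (K : l2n -> H') : \bar R :=
  ereal_sup [set (rnorm (K f))%:E | f in [set f | l2n_norm f <= 1]].

Definition KA (H H' : hilbertType R) (A : H -> H')
    (Fs : forall i, l2 R (L i) -> H) (v : l2n) : H' :=
  \sum_(i < n) A (Fs i (v i)).

Definition penalty (p w alpha : 'I_n -> R) (f : l2n) : \bar R :=
  (\sum_(i < n) (alpha i)%:E * wpsum (p i) (w i) (f i))%E.

Definition Phi (H' : hilbertType R) (K : l2n -> H') (p w alpha : 'I_n -> R)
    (g : H') (f : l2n) : \bar R :=
  ((rnorm (g - K f) ^+ 2)%:E + penalty p w alpha f)%E.

End l2n.

(* J attains its minimum over S at x.  The functionals above are extended-real,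
   and a minimum is a real number: it is not attained at an infinite value. *)
Definition minimizes (R : realType) (T : Type) (J : T -> \bar R) (S : set T)
    (x : T) : Prop :=
  [/\ S x, J x \is a fin_num & forall y, S y -> (J x <= J y)%E].

Definition unique_minimizer (R : realType) (T : Type) (J : T -> \bar R)
    (S : set T) (x : T) : Prop :=
  minimizes J S x /\ forall y, minimizes J S y -> y = x.

(* Main.v *)
Require Import Defs.
From HB Require Import structures.
From mathcomp Require Import all_boot all_order all_algebra.
From mathcomp Require Import sesquilinear complex finmap.
From mathcomp Require Import all_classical all_reals all_analysis.
From mathcomp Require Import ring lra.
From mathcomp.analysis.showcase Require summability.

Set Implicit Arguments.
Unset Strict Implicit.
Unset Printing Implicit Defensive.

Import Order.TTheory GRing.Theory Num.Theory Num.Def.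
Import numFieldNormedType.Exports.

Local Open Scope classical_set_scope.
Local Open Scope ring_scope.

(** Flattening the product of the l2 spaces into one space of square-summable
    families indexed by pairs (i, l) turns the penalty into a single weighted
    sum P of powers |x_s|^(p_s), with weights bounded below, and the operator
    into a linear contraction K ([flat_operator]); K is linear because the sums
    that define the inner product of l2 converge, so that the adjoints are
    linear ([adjoint_linear]).

    Comparing the value of the functional at its minimizer x_t with its value
    at f, the flattened fdag, gives
      |g_t - K x_t|^2 + alpha_t . |||x_t||| <= eps_t^2 + alpha_t . |||f|||.
    When the parameters alpha_t are positive this yields K x_t -> K f and, after
    division by one of them, limsup P(x_t) <= P(f). The convergence then follows
    from [penalized_cvg].
    - Each coordinate converges ([halfplane_cvg]). For small e > 0, the points
      with residual at most e and penalty at most P(f) + e that lie at a fixed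
      distance on one side of f in a given coordinate form a bounded closed
      convex set. If these sets are all nonempty they have a common point,
      because their elements of almost minimal norm form a Cauchy sequence by
      the parallelogram identity ([nested_closed_convex]). That point would be a second minimizer of P.
      This argument takes the place of weak sequential compactness.
    - No mass escapes to infinity: since coordinates converge and the penalties
      do not exceed P(f) in the limit, the penalty of x_t outside a large
      finite set is small, and it controls the l2 norm there ([esum_sq_le]).

    The conditions on the parameters alpha_t force them to have eventually a
    common sign, which may be negative ([weights_sign]). If all of them are negative for some t, the existence
    of a minimizer makes P bounded by the residual on the whole space
    ([negative_weights_bound]); then K is bounded below ([bounded_below]), and
    K x_t -> K f alone implies x_t -> f. *)

(** * The modulus of a complex number *)

Section modulus.
Variable R : realType.
Implicit Types z y : R[i].

Lemma cmod_sqr z : cmod z ^+ 2 = complex.Re z ^+ 2 + complex.Im z ^+ 2.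
Proof. by rewrite /cmod normc_def /= sqr_sqrtr// addr_ge0// sqr_ge0. Qed.

Lemma cmod0 : cmod (0 : R[i]) = 0.
Proof. by rewrite /cmod normr0. Qed.

Lemma cmod_real (x : R) : cmod x%:C%C = `|x|.
Proof. by rewrite /cmod normc_def /= expr0n addr0 sqrtr_sqr. Qed.

Lemma cmodN z : cmod (- z) = cmod z.
Proof. by rewrite /cmod normrN. Qed.

Lemma ReD z y : complex.Re (z + y) = complex.Re z + complex.Re y.
Proof. by case: z y => [? ?] [? ?]. Qed.

Lemma ImD z y : complex.Im (z + y) = complex.Im z + complex.Im y.
Proof. by case: z y => [? ?] [? ?]. Qed.

Lemma ReB z y : complex.Re (z - y) = complex.Re z - complex.Re y.
Proof. by case: z y => [? ?] [? ?]. Qed.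

Lemma ImB z y : complex.Im (z - y) = complex.Im z - complex.Im y.
Proof. by case: z y => [? ?] [? ?]. Qed.

Lemma ler_Re_cmod z : `|complex.Re z| <= cmod z.
Proof.
rewrite -ler_sqr ?nnegrE ?cmod_ge0// real_normK ?num_real//.
by rewrite cmod_sqr lerDl sqr_ge0.
Qed.

Lemma ler_Im_cmod z : `|complex.Im z| <= cmod z.
Proof.
rewrite -ler_sqr ?nnegrE ?cmod_ge0// real_normK ?num_real//.
by rewrite cmod_sqr lerDr sqr_ge0.
Qed.

Lemma cmod_le_ReIm z :
  cmod z <= `|complex.Re z| + `|complex.Im z|.
Proof.
rewrite -ler_sqr ?nnegrE ?cmod_ge0 ?addr_ge0// cmod_sqr sqrrD.
rewrite !real_normK ?num_real// -addrA [X in _ <= _ + X]addrC lerD2l lerDl.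
by rewrite mulrn_wge0// mulr_ge0.
Qed.

Lemma ler_dist_cmod z y : `|cmod z - cmod y| <= cmod (z - y).
Proof.
rewrite ler_norml; apply/andP; split.
  have := cmodD z (y - z); rewrite addrC subrK -[y - z]opprB cmodN; lra.
have := cmodD (z - y) y; rewrite subrK; lra.
Qed.

Lemma cmod_parallelogram z y :
  cmod (z + y) ^+ 2 + cmod (z - y) ^+ 2 = 2 * cmod z ^+ 2 + 2 * cmod y ^+ 2.
Proof.
rewrite !cmod_sqr; case: z => a b; case: y => c d /=; ring.
Qed.

End modulus.

(** * Sums of nonnegative families *)

Section nonneg_esum.
Variables (R : realType) (T : choiceType).
Implicit Types (f g : T -> R) (c : R).

Lemma fsum_le_esum f (A F : set T) : finite_set F -> F `<=` A ->
  ((\sum_(s \in F) f s)%:E <= \esum_(s in A) (f s)%:E)%E.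
Proof.
by move=> finF FA; rewrite -fsumEFin//; apply: ereal_sup_ubound; exists F.
Qed.

Lemma esum_leP f (A : set T) c :
  (forall F : set T, finite_set F -> F `<=` A -> \sum_(s \in F) f s <= c) ->
  (\esum_(s in A) (f s)%:E <= c%:E)%E.
Proof.
move=> h; apply: ge_ereal_sup => _ [F [finF FA] <-].
by rewrite fsumEFin// lee_fin h.
Qed.

Lemma esum_tail f (F : set T) c : (forall s, 0 <= f s) -> finite_set F ->
  (\esum_(s in [set: T]) (f s)%:E <= c%:E)%E ->
  (\esum_(s in ~` F) (f s)%:E <= (c - \sum_(s \in F) f s)%:E)%E.
Proof.
move=> f0 finF; have fE s : (0 <= (f s)%:E)%E by rewrite lee_fin.
rewrite (esumID F)// !setTI esum_fset// fsumEFin// EFinB.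
by rewrite leeBrDl.
Qed.

Lemma cvg_seq_sum (I : Type) (r : seq I) (u : nat -> I -> R) (v : I -> R) :
  (forall s, (fun k => u k s) @ \oo --> v s) ->
  (fun k => \sum_(s <- r) u k s) @ \oo --> \sum_(s <- r) v s.
Proof.
move=> h; elim: r => [|s r ih].
  rewrite big_nil; under eq_fun do rewrite big_nil; exact: cvg_cst.
rewrite big_cons; under eq_fun do rewrite big_cons; exact: cvgD.
Qed.

Lemma cvg_fsum (u : nat -> T -> R) (v : T -> R) (F : set T) :
  finite_set F -> (forall s, (fun k => u k s) @ \oo --> v s) ->
  (fun k => \sum_(s \in F) u k s) @ \oo --> \sum_(s \in F) v s.
Proof.
move=> finF h; rewrite fsbig_finite//=.
rewrite (_ : (fun k => _) = fun k => \sum_(s <- fset_set F) u k s); last first.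
  by apply/funext => k; rewrite fsbig_finite.
exact: cvg_seq_sum.
Qed.

(** Fatou's lemma for the counting measure: every finite partial sum passes to
    the limit. *)
Lemma esum_fatou (u : nat -> T -> R) (v : T -> R) c :
  (forall k s, 0 <= u k s) -> (forall s, (fun k => u k s) @ \oo --> v s) ->
  (\forall k \near \oo, (\esum_(s in [set: T]) (u k s)%:E <= c%:E)%E) ->
  (\esum_(s in [set: T]) (v s)%:E <= c%:E)%E.
Proof.
move=> u0 uv uc; apply: esum_leP => F finF _.
apply: (cvgr_to_le (cvg_fsum finF uv)); near=> k.
rewrite -lee_fin; apply: le_trans (fsum_le_esum (u k) finF (@subsetT _ _)) _.
by near: k.
Unshelve. all: by end_near. Qed.

End nonneg_esum.

(** * The Hilbert space of square-summable families *)

Section square_summable.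
Variables (R : realType) (T : countType).
Implicit Types x y : l2 R T.

Definition nsq x : R := fine (sqsum x).

Lemma sqsum_fin x : sqsum x = (nsq x)%:E.
Proof.
rewrite /nsq fineK// ge0_fin_numE; first by have := l2P x; rewrite inE.
by apply: esum_ge0 => s _; rewrite lee_fin sqr_ge0.
Qed.

Lemma nsq_ge0 x : 0 <= nsq x.
Proof.
by rewrite -lee_fin -sqsum_fin; apply: esum_ge0 => s _; rewrite lee_fin sqr_ge0.
Qed.

Lemma cmod_coord_le x s : cmod (x s) ^+ 2 <= nsq x.
Proof.
rewrite -lee_fin -sqsum_fin.
apply: le_trans (fsum_le_esum _ (finite_set1 s) (@subsetT _ _)).
by rewrite fsbig_set1.
Qed.

Lemma l2DE x y s : (x + y) s = x s + y s. Proof. by []. Qed.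
Lemma l2BE x y s : (x - y) s = x s - y s. Proof. by []. Qed.
Lemma l2ZE (c : R[i]) x s : (c *: x) s = c * x s. Proof. by []. Qed.

Lemma l2_eqP x y : (forall s, x s = y s) -> x = y.
Proof. by move=> xy; apply/val_inj/funext. Qed.

Lemma esumZl (S : choiceType) (c : R) (f : S -> R) (r : R) : 0 <= c ->
  (forall s, 0 <= f s) -> \esum_(s in [set: S]) (f s)%:E = r%:E ->
  \esum_(s in [set: S]) (c * f s)%:E = (c * r)%:E.
Proof.
rewrite le_eqVlt => /predU1P[<- _ _|c0 f0 fr].
  by rewrite mul0r; apply: esum1 => s _; rewrite mul0r.
have le (d : R) (g : S -> R) (t : R) : 0 <= d -> (forall s, 0 <= g s) ->
    \esum_(s in [set: S]) (g s)%:E = t%:E ->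
    (\esum_(s in [set: S]) (d * g s)%:E <= (d * t)%:E)%E.
  move=> d0 g0 gt; apply: esum_leP => F finF _; rewrite -mulr_fsumr.
  by rewrite ler_wpM2l// -lee_fin -gt; exact: fsum_le_esum.
apply/eqP; rewrite eq_le (le c f r (ltW c0) f0 fr)/=.
have := le c f r (ltW c0) f0 fr.
case E : (\esum_(s in [set: S]) (c * f s)%:E)%E => [t| |] //=; last first.
  have : (0 <= \esum_(s in [set: S]) (c * f s)%:E)%E.
    by apply: esum_ge0 => s _; rewrite lee_fin mulr_ge0 ?(ltW c0).
  by rewrite E.
move=> _; have cf0 s : 0 <= c * f s by rewrite mulr_ge0// ltW.
have ci0 : 0 <= c^-1 by rewrite invr_ge0 ltW.
have := le c^-1 (fun s => c * f s) t ci0 cf0 E.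
under eq_esum => s _ do rewrite mulKf ?gt_eqF//.
by rewrite fr !lee_fin ler_pdivlMl.
Qed.

Lemma nsqZ (c : R[i]) x : nsq (c *: x) = cmod c ^+ 2 * nsq x.
Proof.
apply: EFin_inj; rewrite -sqsum_fin.
transitivity (\esum_(s in [set: T]) (cmod c ^+ 2 * cmod (x s) ^+ 2)%:E)%E.
  by apply: eq_esum => s _; rewrite l2ZE cmodM exprMn.
by apply: esumZl; [exact: sqr_ge0|move=> s; exact: sqr_ge0|exact: sqsum_fin].
Qed.

Lemma nsq_parallelogram x y :
  nsq (x + y) + nsq (x - y) = 2 * nsq x + 2 * nsq y.
Proof.
have sq0 (z : l2 R T) s : [set: T] s -> (0 <= (cmod (z s) ^+ 2)%:E)%E.
  by rewrite lee_fin sqr_ge0.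
apply: EFin_inj; rewrite !EFinD -!sqsum_fin.
have E (z : l2 R T) : (2 * nsq z)%:E =
    \esum_(s in [set: T]) (2 * cmod (z s) ^+ 2)%:E.
  by apply/esym/esumZl => [//|s|]; [exact: sqr_ge0|exact: sqsum_fin].
have sq2 (z : l2 R T) s : [set: T] s -> (0 <= (2 * cmod (z s) ^+ 2)%:E)%E.
  by rewrite lee_fin mulr_ge0// sqr_ge0.
rewrite !E /sqsum -!esumD; do ?[exact: sq0|exact: sq2].
by apply: eq_esum => s _; rewrite -!EFinD l2DE l2BE cmod_parallelogram.
Qed.

Lemma nsqBC x y : nsq (x - y) = nsq (y - x).
Proof.
by rewrite -opprB -scaleN1r nsqZ cmodN /cmod normr1 expr1n mul1r.
Qed.

Lemma real_cauchy_cvg (u : nat -> R) :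
  (forall e : R, 0 < e -> exists N, forall m k,
     (N <= m)%N -> (N <= k)%N -> `|u m - u k| <= e) -> cvg (u @ \oo).
Proof.
move=> uC; apply: cauchy_cvg; apply/cauchy_exP => e e0.
have [|N uN] := uC (e / 2); first by rewrite divr_gt0.
exists (u N); exists N => // k /= Nk; rewrite /ball/=.
by apply: le_lt_trans (uN _ _ (leqnn N) Nk) _; rewrite ltr_pdivrMr//; lra.
Qed.

(** Real and imaginary parts of each coordinate are Cauchy; their limits give
    the limit in norm by Fatou's lemma applied to x m - x k as k grows. *)
Lemma l2_complete (x : nat -> l2 R T) :
  (forall e : R, 0 < e -> exists N, forall m k,
     (N <= m)%N -> (N <= k)%N -> nsq (x m - x k) <= e) ->
  exists y, (fun k => nsq (x k - y)) @ \oo --> (0 : R).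
Proof.
move=> xC.
have coord (q : R[i] -> R) (s : T) : (forall z, `|q z| <= cmod z) ->
    (forall z1 z2 : R[i], q (z1 - z2) = q z1 - q z2) ->
    cvg ((fun k => q (x k s)) @ \oo).
  move=> qle qB; apply: real_cauchy_cvg => e e0.
  have [|N xN] := xC (e ^+ 2); first by rewrite exprn_gt0.
  exists N => m k Nm Nk; rewrite -qB; apply: le_trans (qle _) _.
  rewrite -ler_sqr ?nnegrE ?cmod_ge0 ?(ltW e0)//.
  by apply: le_trans (xN _ _ Nm Nk); exact: (cmod_coord_le (x m - x k)).
pose a (s : T) : R := lim ((fun k => complex.Re (x k s)) @ \oo).
pose b (s : T) : R := lim ((fun k => complex.Im (x k s)) @ \oo).
have ax s : (fun k => complex.Re (x k s)) @ \oo --> a s.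
  by apply: (coord _ s (@ler_Re_cmod R) (@ReB R)).
have bx s : (fun k => complex.Im (x k s)) @ \oo --> b s.
  by apply: (coord _ s (@ler_Im_cmod R) (@ImB R)).
pose y0 (s : T) : R[i] := Complex (a s) (b s).
have cv (z : R[i]) s : (fun k => cmod (z - x k s) ^+ 2) @ \oo -->
    cmod (z - y0 s) ^+ 2.
  have d (u : nat -> R) l c : u @ \oo --> l ->
      (fun k => (c - u k) ^+ 2) @ \oo --> (c - l) ^+ 2.
    move=> ul; have cul : (fun k => c - u k) @ \oo --> c - l.
      by apply: cvgB => //; exact: cvg_cst.
    by rewrite expr2; under eq_fun do rewrite expr2; exact: cvgM.
  rewrite cmod_sqr ReB ImB; under eq_fun do rewrite cmod_sqr ReB ImB.
  exact: cvgD (d _ _ _ (ax s)) (d _ _ _ (bx s)).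
have fat (e : R) : 0 < e -> exists N, forall m, (N <= m)%N ->
    (sqsum (fun s => x m s - y0 s)%R <= e%:E)%E.
  move=> e0; have [N xN] := xC _ e0; exists N => m Nm.
  apply: (@esum_fatou _ _ (fun k s => cmod (x m s - x k s) ^+ 2)
    (fun s => cmod (x m s - y0 s) ^+ 2)) => [k s|s|].
  - exact: sqr_ge0.
  - exact: cv.
  exists N => // k /= Nk; move: (xN _ _ Nm Nk).
  by rewrite -lee_fin -sqsum_fin.
(* The limit is x N minus a square-summable family, hence square-summable. *)
have [N xN] := fat 1 ltr01.
have dP : (fun s => x N s - y0 s) \in @l2_pred R T.
  by rewrite inE /=; apply: le_lt_trans (xN _ (leqnn _)) (ltry _).
exists (x N - L2 dP).
apply/cvgr0Pnorm_le => e e0; have [M xM] := fat _ e0; exists M => // k /= Mk.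
rewrite ger0_norm ?nsq_ge0// -lee_fin -sqsum_fin.
rewrite (_ : sqsum _ = sqsum (fun s => x k s - y0 s)); first exact: xM.
by congr sqsum; apply/funext => s; rewrite !l2BE /= subKr.
Qed.

End square_summable.

Lemma ler_fsum (R : realType) (T : choiceType) (F : set T) (f g : T -> R) :
  finite_set F -> (forall s, F s -> f s <= g s) ->
  \sum_(s \in F) f s <= \sum_(s \in F) g s.
Proof.
move=> finF fg; rewrite -lee_fin -!fsumEFin//.
by apply: lee_fsum => // s Fs; rewrite lee_fin fg.
Qed.

(** * Decreasing sequences of closed convex sets *)

Lemma cvg0P (R : realType) (u : nat -> R) :
  u @ \oo --> (0 : R) <->
  forall e, 0 < e -> exists N, forall k, (N <= k)%N -> `|u k| <= e.
Proof.
split=> [/cvgr0Pnorm_le h e e0|h]; first by have [N _ uN] := h e e0; exists N.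
by apply/cvgr0Pnorm_le => e /h[N uN]; exists N.
Qed.

Section nested.
Variables (R : realType) (T : countType).
Implicit Types (x y : l2 R T) (D : nat -> set (l2 R T)).

Definition midpoint x y : l2 R T := (2^-1 : R)%:C%C *: (x + y).

Lemma midpointE x y s : midpoint x y s = (2^-1 : R)%:C%C * (x s + y s).
Proof. by []. Qed.

Lemma nsq_midpoint x y :
  nsq (x - y) = 2 * nsq x + 2 * nsq y - 4 * nsq (midpoint x y).
Proof.
rewrite /midpoint nsqZ cmod_real ger0_norm ?invr_ge0// -nsq_parallelogram.
by field.
Qed.

(** With d k the infimum of the squared norm on D k, elements x k of D k with
    squared norm close to d k form a Cauchy sequence, whose limit lies in every
    D k: for k <= m the midpoint of x k and x m lies in D k, so [nsq_midpoint]
    bounds the squared distance by about 2 (d m - d k), and d is nondecreasing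
    and bounded. Midpoints are the only convex combinations that occur. *)
Lemma nested_closed_convex D (B : R) :
  (forall k m, (k <= m)%N -> D m `<=` D k) ->
  (forall k, D k !=set0) ->
  (forall k x y, D k x -> D k y -> D k (midpoint x y)) ->
  (forall k (u : nat -> l2 R T) y, (forall j, D k (u j)) ->
     (fun j => nsq (u j - y)) @ \oo --> (0 : R) -> D k y) ->
  (forall x, D 0 x -> nsq x <= B) ->
  exists y, forall k, D k y.
Proof.
move=> Dnest Dne Dmid Dcl DB.
pose d k := inf (@nsq R T @` D k).
have dlb k : has_lbound (@nsq R T @` D k).
  by exists 0 => _ [x _ <-]; exact: nsq_ge0.
have dle k x : D k x -> d k <= nsq x.
  by move=> Dx; apply: ge_inf (dlb k) _ _; exists x.
have dne k : nonempty (@nsq R T @` D k).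
  by have [x Dx] := Dne k; exists (nsq x), x.
have /choice[x xP] k : exists x, D k x /\ nsq x < d k + harmonic k.
  have [_ [x Dx <-] xd] :=
    inf_adherent (harmonic_gt0 k) (conj (dne k) (dlb k)).
  by exists x.
have dnd : nondecreasing_seq d.
  move=> k m km; apply: lb_le_inf (dne m) _ => _ [y Dy <-].
  exact/dle/(Dnest _ _ km).
have dcv : cvgn d.
  apply: nondecreasing_is_cvgn => //; exists B => _ [k _ <-].
  have [y Dy] := Dne k; apply: le_trans (dle _ _ Dy) _.
  exact/DB/(Dnest _ _ (leq0n k)).
have xx k m : (k <= m)%N ->
    nsq (x m - x k) <= 2 * (limn d - d k) + 4 * harmonic k.
  move=> km; rewrite nsq_midpoint.
  have [Dxk xk] := xP k; have [Dxm xm] := xP m.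
  have := dle _ _ (Dmid _ _ _ (Dnest _ _ km _ Dxm) Dxk).
  have := nondecreasing_cvgn_le dnd dcv m.
  have : harmonic m <= harmonic k :> R.
    by rewrite /harmonic lef_pV2 ?posrE// ler_nat ltnS.
  by lra.
have [|y xy] := @l2_complete _ _ x.
  move=> e e0.
  have bnd : (fun k => 2 * (limn d - d k) + 4 * harmonic k) @ \oo --> (0 : R).
    rewrite [X in _ --> X](_ : 0 = 2 * (limn d - limn d) + 4 * 0); last first.
      by rewrite subrr !mulr0 addr0.
    apply: cvgD; apply: cvgM; try exact: cvg_cst; last exact: cvg_harmonic.
    by apply: cvgB => //; exact: cvg_cst.
  have [N bN] := (cvg0P _).1 bnd _ e0.
  exists N => m k Nm Nk.
  wlog km : m k Nm Nk / (k <= m)%N.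
    move=> h; case/orP: (leq_total k m) => [/h-> //|km].
    by rewrite nsqBC h.
  apply: le_trans (xx _ _ km) _; apply: le_trans (ler_norm _) _.
  exact: bN.
exists y => k; apply: (Dcl k (fun j => x (j + k)%N)).
  move=> j; apply: (Dnest k (j + k)%N); first exact: leq_addl.
  by have [] := xP (j + k)%N.
apply/cvg0P => e e0; have [N xN] := (cvg0P _).1 xy _ e0.
by exists N => j Nj; apply: xN; exact: leq_trans (leq_addr _ _).
Qed.

End nested.

(** * Powers with exponent between 1 and 2 *)

Section power.
Variable R : realType.
Implicit Types (t p : R).

Lemma powR_midpoint (p a b : R) : 1 <= p -> 0 <= a -> 0 <= b ->
  (2^-1 * (a + b)) `^ p <= 2^-1 * (a `^ p + b `^ p).
Proof.
move=> p1 a0 b0.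
have h01 : 0 <= (2^-1 : R) <= 1 by apply/andP; split; lra.
pose half := Itv01 (proj1 (andP h01)) (proj2 (andP h01)).
have := @convex_powR R p p1 half a b.
rewrite !inE /= !in_itv /= a0 b0 => /(_ isT isT) h.
rewrite [X in _ <= X]convRE [X in X `^ _ <= _]convRE /= /unstable.onem in h.
have E : 1 - 2^-1 = 2^-1 :> R by field.
by rewrite E -!mulrDr in h.
Qed.

(** Away from 0 the power function is differentiable; at 0 it is dominated by
    its argument. *)
Lemma powR_base_cvg p (u : nat -> R) t : 1 <= p -> (forall k, 0 <= u k) ->
  u @ \oo --> t -> (fun k => u k `^ p) @ \oo --> t `^ p.
Proof.
move=> p1 u0 ut; have p0 : p != 0 by rewrite gt_eqF// (lt_le_trans _ p1).
have t0 : 0 <= t by apply: (cvgr_to_ge ut); exact: nearW.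
case: (ltgtP t 0) t0 => // [t0 _|t00 _]; last first.
  rewrite t00 powR0//; rewrite t00 in ut.
  apply/cvg0P => e e0; have [M uM] := (cvg0P _).1 ut _ e0.
  have [N uN] := (cvg0P _).1 ut _ ltr01.
  exists (maxn M N) => k; rewrite geq_max => /andP[Mk Nk].
  rewrite ger0_norm ?powR_ge0//; apply: le_trans (uM _ Mk).
  have [->|uk0] := eqVneq (u k) 0; first by rewrite powR0// normr0.
  rewrite ger0_norm//; apply: ge1r_powR => //.
  by rewrite lt_neqAle eq_sym uk0 u0 (le_trans (ler_norm _) (uN _ Nk)).
have tc : {for t, continuous (@powR R ^~ p)}.
  apply/differentiable_continuous/derivable1_diffP/derivable_powR.
  by rewrite in_itv /= t0.
exact: cvg_comp ut tc.
Qed.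

(** Below 1 the square is at most the p-th power, above 1 it is at most the
    square of the p-th power. *)
Lemma sqr_le_powR p t : 1 <= p <= 2 -> 0 <= t ->
  t ^+ 2 <= t `^ p * (1 + t `^ p).
Proof.
move=> /andP[p1 p2] t0; have [t1|t1] := leP t 1.
  have [->|tn0] := eqVneq t 0.
    by rewrite expr0n mulr_ge0 ?addr_ge0 ?powR_ge0.
  apply: (@le_trans _ _ (t `^ p)); last first.
    by rewrite ler_peMr ?powR_ge0// lerDl powR_ge0.
  rewrite -powR_mulrn//; apply: ger_powR => //.
  by rewrite lt0r tn0 t0 t1.
have tp := le1r_powR (ltW t1) p1.
have := powR_ge0 t p; nra.
Qed.

End power.

(** * The penalty on a single sequence space *)

Section penalty_functional.
Variables (R : realType) (T : countType) (p w : T -> R) (w0 : R).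
Hypotheses (hp : forall s, 1 <= p s <= 2) (w0_gt0 : 0 < w0)
  (hw : forall s, w0 <= w s).
Implicit Types (x y : l2 R T) (z : R[i]).

Definition wterm (s : T) (z : R[i]) : R := w s * cmod z `^ p s.

Definition wpen x : \bar R := \esum_(s in [set: T]) (wterm s (x s))%:E.

Let w_ge0 s : 0 <= w s. Proof. exact: le_trans (ltW w0_gt0) (hw s). Qed.

Lemma wterm_ge0 s z : 0 <= wterm s z.
Proof. by rewrite /wterm mulr_ge0 ?powR_ge0. Qed.

Lemma wpen_ge0 x : (0 <= wpen x)%E.
Proof. by apply: esum_ge0 => s _; rewrite lee_fin wterm_ge0. Qed.

Lemma wpen_midpoint x y c : (wpen x <= c%:E)%E -> (wpen y <= c%:E)%E ->
  (wpen (midpoint x y) <= c%:E)%E.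
Proof.
move=> xc yc; apply: esum_leP => F finF _.
apply: (@le_trans _ _ (2^-1 * (\sum_(s \in F) wterm s (x s) +
                               \sum_(s \in F) wterm s (y s)))).
  rewrite -fsbig_split//= mulr_fsumr; apply: ler_fsum => // s _.
  rewrite /wterm -mulrDr mulrCA ler_wpM2l//.
  have [p1 _] := andP (hp s); apply: le_trans (powR_midpoint p1 _ _).
  - apply: ge0_ler_powR; rewrite ?nnegrE ?cmod_ge0 ?(le_trans _ p1)//.
      by rewrite mulr_ge0 ?invr_ge0 ?addr_ge0 ?cmod_ge0.
    rewrite [X in cmod X]midpointE cmodM cmod_real ger0_norm ?invr_ge0//.
    by rewrite ler_wpM2l ?invr_ge0 ?cmodD.
  - exact: cmod_ge0.
  - exact: cmod_ge0.
have le x' : (wpen x' <= c%:E)%E -> \sum_(s \in F) wterm s (x' s) <= c.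
  move=> xc'; rewrite -lee_fin.
  exact: le_trans (fsum_le_esum _ finF (@subsetT _ _)) xc'.
have := le _ xc; have := le _ yc; lra.
Qed.

Lemma nsq_cvg_coord (u : nat -> l2 R T) y s :
  (fun j => nsq (u j - y)) @ \oo --> (0 : R) ->
  (fun j => cmod (u j s - y s)) @ \oo --> (0 : R).
Proof.
move=> uy; apply/cvg0P => e e0.
have e2 : 0 < e ^+ 2 by rewrite exprn_gt0.
have [N uN] := (cvg0P _).1 uy _ e2; exists N => // k Nk.
rewrite ger0_norm ?cmod_ge0// -ler_sqr ?nnegrE ?cmod_ge0 ?(ltW e0)//.
apply: le_trans (cmod_coord_le (u k - y) s) _.
by apply: le_trans (ler_norm _) _; exact: uN.
Qed.

Lemma wterm_cvg (u : nat -> R[i]) z s :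
  (fun j => cmod (u j - z)) @ \oo --> (0 : R) ->
  (fun j => wterm s (u j)) @ \oo --> wterm s z.
Proof.
move=> uz; rewrite /wterm; apply: cvgM; first exact: cvg_cst.
have [p1 _] := andP (hp s).
apply: powR_base_cvg => // [k|]; first exact: cmod_ge0.
apply/cvgrPdist_le => e e0.
have [N uN] := (cvg0P _).1 uz _ e0; exists N => // k /= Nk.
rewrite distrC; apply: le_trans (ler_dist_cmod _ _) _.
by apply: le_trans (ler_norm _) _; exact: uN.
Qed.

Lemma wpen_closed (u : nat -> l2 R T) y c :
  (forall j, (wpen (u j) <= c%:E)%E) ->
  (fun j => nsq (u j - y)) @ \oo --> (0 : R) -> (wpen y <= c%:E)%E.
Proof.
move=> uc uy; apply: (@esum_fatou _ _ (fun j s => wterm s (u j s))).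
- by move=> k s; exact: wterm_ge0.
- by move=> s; exact/wterm_cvg/nsq_cvg_coord.
- exact: nearW.
Qed.

Definition sqbound (c : R) : R := c / w0 * (1 + c / w0).

(** For an exponent at most 2 the penalty on a set of indices controls the l2
    norm there: each p-th power is at most c / w0, and [sqr_le_powR] bounds the
    square by the p-th power times 1 + c / w0. It is stated for an arbitrary
    set of indices because it is applied to complements of finite sets. *)
Lemma esum_sq_le (A : set T) (x : T -> R[i]) c :
  (\esum_(s in A) (wterm s (x s))%:E <= c%:E)%E ->
  (\esum_(s in A) (cmod (x s) ^+ 2)%:E <= (sqbound c)%:E)%E.
Proof.
move=> xc; apply: esum_leP => F finF FA.
have Fle G : finite_set G -> G `<=` A ->
    \sum_(s \in G) cmod (x s) `^ p s <= c / w0.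
  move=> finG GA; rewrite ler_pdivlMr// mulrC mulr_fsumr.
  apply: (@le_trans _ _ (\sum_(s \in G) wterm s (x s))).
    by apply: ler_fsum => // s _; rewrite /wterm ler_wpM2r ?powR_ge0.
  by rewrite -lee_fin; exact: le_trans (fsum_le_esum _ finG GA) xc.
have c0 : 0 <= c / w0.
  by have := Fle set0 (finite_set0 _) (@sub0set _ _); rewrite fsbig_set0.
apply: (@le_trans _ _ (\sum_(s \in F) (cmod (x s) `^ p s * (1 + c / w0)))).
  apply: ler_fsum => // s Fs.
  apply: le_trans (sqr_le_powR (hp s) (cmod_ge0 _)) _.
  rewrite ler_wpM2l ?powR_ge0// lerD2l.
  have := Fle [set s] (finite_set1 _); rewrite fsbig_set1; apply.
  by move=> _ ->; exact: FA.
rewrite -mulr_fsuml ler_wpM2r ?addr_ge0//; exact: Fle.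
Qed.

End penalty_functional.

(** * The real-valued norm of a complex normed module *)

Section real_norm.
Variables (R : realType) (V : normedModType R[i]).
Implicit Types u v : V.

Lemma rnormE v : (rnorm v)%:C%C = `|v|.
Proof. by rewrite /rnorm RRe_real// normr_real. Qed.

Lemma rnorm_ge0 v : 0 <= rnorm v.
Proof. by rewrite -lecR rnormE normr_ge0. Qed.

Lemma rnorm_eq0 v : rnorm v = 0 -> v = 0.
Proof. by move=> v0; apply/normr0_eq0; rewrite -rnormE v0. Qed.

Lemma rnormZ (c : R[i]) v : rnorm (c *: v) = cmod c * rnorm v.
Proof. by apply: complexI; rewrite rnormE normrZ rmorphM/= rnormE cmodE. Qed.

Lemma rnormD u v : rnorm (u + v) <= rnorm u + rnorm v.
Proof. by rewrite -lecR rmorphD/= !rnormE ler_normD. Qed.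

Lemma rnormB u v : rnorm (u - v) <= rnorm u + rnorm v.
Proof. by apply: le_trans (rnormD _ _) _; rewrite /rnorm normrN. Qed.

Lemma half_double v : v = (2^-1 : R)%:C%C *: (v + v).
Proof.
rewrite scalerDr -scalerDl -rmorphD/= -[LHS]scale1r; congr (_ *: _).
by rewrite (_ : 2^-1 + 2^-1 = 1 :> R)//; field.
Qed.

End real_norm.

(** * Convergence of near-minimizers *)

Section penalized_convergence.
Variables (R : realType) (T : countType) (p w : T -> R) (w0 : R).
Hypotheses (hp : forall s, 1 <= p s <= 2) (w0_gt0 : 0 < w0)
  (hw : forall s, w0 <= w s).
Variables (V : normedModType R[i]) (K : {linear l2 R T -> V}).
Hypothesis K_contr : forall x, rnorm (K x) ^+ 2 <= nsq x.
Variables (f : l2 R T) (Pf : R).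
Hypotheses (f_pen : wpen p w f = Pf%:E)
  (f_uniq : forall y, K y = K f -> (wpen p w y <= Pf%:E)%E -> y = f).
Variables (x : nat -> l2 R T) (U : nat -> R).
Hypotheses (Kx : (fun t => rnorm (K (x t) - K f)) @ \oo --> (0 : R))
  (x_pen : \forall t \near \oo, (wpen p w (x t) <= (U t)%:E)%E)
  (U_cvg : U @ \oo --> Pf).

Lemma nsq_le_pen (y : l2 R T) c : (wpen p w y <= c%:E)%E ->
  nsq y <= sqbound w0 c.
Proof.
move=> yc; rewrite -lee_fin -sqsum_fin; exact: (esum_sq_le hp w0_gt0 hw yc).
Qed.

Lemma eventually_near_min e : 0 < e ->
  \forall t \near \oo, rnorm (K (x t) - K f) <= e /\
                       (wpen p w (x t) <= (Pf + e)%:E)%E.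
Proof.
move=> e0; near=> t; split.
  apply: le_trans (ler_norm _) _; near: t.
  by have [N KN] := (cvg0P _).1 Kx _ e0; exists N.
have h : (wpen p w (x t) <= (U t)%:E)%E by near: t.
apply: le_trans h _; rewrite lee_fin -lerBlDl.
apply: le_trans (ler_norm _) _; rewrite distrC; near: t.
move/cvgrPdist_le : U_cvg; exact.
Unshelve. all: by end_near. Qed.

(** The map q is a real-linear functional on the complex plane, applied to one
    coordinate. If q (x t s - f s) were at least d infinitely often, the sets of
    near-minimizers y with q (y s - f s) >= d would all be nonempty, and a
    common point of them would be a minimizer different from f. *)
Lemma halfplane_cvg (s : T) (q : R[i] -> R) (d : R) :
  (forall z1 z2, q (z1 + z2) = q z1 + q z2) ->
  (forall (r : R) z, q (r%:C%C * z) = r * q z) ->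
  (forall z, `|q z| <= cmod z) -> 0 < d ->
  \forall t \near \oo, q (x t s - f s) < d.
Proof.
move=> qD qZ q_le d0; apply/not_notP => nev.
have freq N : exists2 t, (N <= t)%N & d <= q (x t s - f s).
  apply: contrapT => h; apply: nev; exists N => // t /= Nt.
  by rewrite ltNge; apply/negP => dt; apply: h; exists t.
have [h [h_gt0 h_le h_small]] : exists h : nat -> R, [/\ forall k, 0 < h k,
    forall k m, (k <= m)%N -> h m <= h k &
    forall e, 0 < e -> exists k, h k <= e].
  exists harmonic; split=> [k|k m km|e e0]; first exact: harmonic_gt0.
    by rewrite /harmonic lef_pV2 ?posrE// ler_nat ltnS.
  have [N hN] := (cvg0P _).1 (@cvg_harmonic R) _ e0.
  by exists N; exact: le_trans (ler_norm _) (hN _ (leqnn _)).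
pose D k := [set y : l2 R T | [/\ rnorm (K y - K f) <= h k,
  (wpen p w y <= (Pf + h k)%:E)%E & d <= q (y s - f s)]].
have [| | | | |y Dy] := @nested_closed_convex _ _ D (sqbound w0 (Pf + h 0)).
- move=> k m km y [Ky Py dy]; split => //.
    exact: le_trans Ky (h_le _ _ km).
  by apply: le_trans Py _; rewrite lee_fin lerD2l h_le.
- move=> k; have [N _ xN] := eventually_near_min (h_gt0 k).
  by have [t Nt dt] := freq N; exists (x t); have [] := xN _ Nt; split.
- move=> k y z [Ky Py dy] [Kz Pz dz]; split.
  + rewrite /midpoint linearZ linearD /= [X in _ - X](half_double (K f)).
    rewrite -scalerBr opprD addrACA rnormZ cmod_real ger0_norm ?invr_ge0//.
    apply: (@le_trans _ _ (2^-1 * (rnorm (K y - K f) + rnorm (K z - K f)))).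
      by rewrite ler_wpM2l ?invr_ge0// rnormD.
    by lra.
  + exact: (wpen_midpoint hp w0_gt0 hw).
  + rewrite midpointE [X in _ - X](half_double (f s : R[i]^o)).
    rewrite -[X in _ - X]/((2^-1 : R)%:C%C * (f s + f s)) -mulrBr opprD addrACA.
    rewrite qZ qD; lra.
- move=> k v y vD vy; split.
  + have Kv : (fun j => rnorm (K (v j) - K y)) @ \oo --> (0 : R).
      apply/cvg0P => e e0; have e2 : 0 < e ^+ 2 by rewrite exprn_gt0.
      have [N vN] := (cvg0P _).1 vy _ e2; exists N => j Nj.
      rewrite ger0_norm ?rnorm_ge0// -ler_sqr ?nnegrE ?rnorm_ge0 ?(ltW e0)//.
      rewrite -linearB; apply: le_trans (K_contr _) _.
      exact: le_trans (ler_norm _) (vN _ Nj).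
    apply/ler_addgt0Pr => e e0; have [N vN] := (cvg0P _).1 Kv _ e0.
    have [KN _ _] := vD N; have := vN N (leqnn _).
    rewrite ger0_norm ?rnorm_ge0// => KvN.
    have -> : K y - K f = (K (v N) - K f) - (K (v N) - K y).
      by rewrite opprB [RHS]addrC addrA subrK.
    exact: le_trans (rnormB _ _) (lerD KN KvN).
  + by apply: (wpen_closed hp w0_gt0 hw _ vy) => j; have [] := vD j.
  + apply/ler_addgt0Pr => e e0.
    have [N vN] := (cvg0P _).1 (nsq_cvg_coord s vy) _ e0.
    have [_ _ dN] := vD N; apply: le_trans dN _.
    have -> : v N s - f s = (y s - f s) + (v N s - y s).
      by rewrite [RHS]addrC addrA subrK.
    rewrite qD lerD2l; apply: le_trans (ler_norm _) _.
    apply: le_trans (q_le _) _; apply: le_trans (ler_norm _) _.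
    exact: vN.
- by move=> y [_ Py _]; exact: nsq_le_pen.
have yf : y = f.
  apply: f_uniq.
    apply/eqP; rewrite -subr_eq0; apply/eqP/rnorm_eq0/le_anti.
    rewrite rnorm_ge0 andbT; apply/ler_addgt0Pr => e /h_small[k ke].
    by have [Ky _ _] := Dy k; rewrite add0r; exact: le_trans ke.
  apply/lee_addgt0Pr => e /h_small[k ke]; have [_ Py _] := Dy k.
  by apply: le_trans Py _; rewrite -EFinD lee_fin lerD2l.
have [_ _] := Dy 0; rewrite yf subrr => /le_trans/(_ (ler_norm _)).
by move/le_trans/(_ (q_le _)); rewrite cmod0 leNgt d0.
Qed.

(** A complex number is small as soon as its real part, its imaginary part and
    their opposites are bounded above by a small number. *)
Lemma coord_cvg (s : T) : (fun t => cmod (x t s - f s)) @ \oo --> (0 : R).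
Proof.
have ReZ (r : R) z : complex.Re (r%:C%C * z) = r * complex.Re z.
  by case: z => a b /=; ring.
have ImZ (r : R) z : complex.Im (r%:C%C * z) = r * complex.Im z.
  by case: z => a b /=; ring.
apply/cvgr0Pnorm_le => e e0; have e2 : 0 < e / 2 by rewrite divr_gt0.
near=> t; rewrite ger0_norm ?cmod_ge0//.
have Re1 : complex.Re (x t s - f s) < e / 2.
  near: t; exact: halfplane_cvg (@ReD R) ReZ (@ler_Re_cmod R) e2.
have Im1 : complex.Im (x t s - f s) < e / 2.
  near: t; exact: halfplane_cvg (@ImD R) ImZ (@ler_Im_cmod R) e2.
have Re2 : - complex.Re (x t s - f s) < e / 2.
  near: t; apply: (halfplane_cvg (q := fun z => - complex.Re z) s _ _ _ e2).
  - by move=> z1 z2; rewrite ReD opprD.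
  - by move=> r z; rewrite ReZ mulrN.
  - by move=> z; rewrite normrN; exact: ler_Re_cmod.
have Im2 : - complex.Im (x t s - f s) < e / 2.
  near: t; apply: (halfplane_cvg (q := fun z => - complex.Im z) s _ _ _ e2).
  - by move=> z1 z2; rewrite ImD opprD.
  - by move=> r z; rewrite ImZ mulrN.
  - by move=> z; rewrite normrN; exact: ler_Im_cmod.
apply: le_trans (cmod_le_ReIm _) _; rewrite [e]splitr lerD//.
  by rewrite ler_norml; apply/andP; split; lra.
by rewrite ler_norml; apply/andP; split; lra.
Unshelve. all: by end_near. Qed.

(** A finite set F carries the penalty of f up to h. Coordinatewise convergence
    on F and the upper bound on the penalties leave a penalty of at most 3 h for
    x t outside F, hence a small l2 norm there. *)
Theorem penalized_cvg : (fun t => nsq (x t - f)) @ \oo --> (0 : R).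
Proof.
apply/cvgr0Pnorm_le => e e0.
(* The final bound is h + 24 k with h = w0 k, and 3 k <= 1 bounds
   [sqbound w0 (3 * h)] by 6 k. *)
pose k := Num.min (3^-1) (e / (w0 + 24)).
have k0 : 0 < k by rewrite lt_min invr_gt0 ltr0n divr_gt0// addr_gt0.
have k3 : k <= 3^-1 by rewrite ge_min lexx.
have ke : k * (w0 + 24) <= e.
  by rewrite -ler_pdivlMr ?addr_gt0// ge_min lexx orbT.
pose h := w0 * k; have h0 : 0 < h by rewrite mulr_gt0.
have Gle : sqbound w0 (3 * h) <= 6 * k.
  have -> : sqbound w0 (3 * h) = 3 * k * (1 + 3 * k).
    by rewrite /sqbound /h; field; rewrite gt_eqF.
  by nra.
have [_ [F [finF _] <-]] : exists2 y,
    [set (\sum_(s \in A) (wterm p w s (f s))%:E)%E | A in fsets [set: T]] y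
    & ((Pf - h)%:E < y)%E.
  apply: ereal_sup_gt; change ((Pf - h)%:E < wpen p w f)%E.
  by rewrite f_pen lte_fin ltrBlDr ltrDl.
rewrite fsumEFin// lte_fin => FPf.
have wF : (fun t => \sum_(s \in F) wterm p w s (x t s)) @ \oo -->
    \sum_(s \in F) wterm p w s (f s).
  by apply: cvg_fsum => // s; exact/wterm_cvg/coord_cvg.
have sqF : (fun t => \sum_(s \in F) cmod (x t s - f s) ^+ 2) @ \oo --> (0 : R).
  rewrite [X in _ --> X](_ : 0 = \sum_(s \in F) (0 : R));
    last by rewrite fsbig1.
  apply: (@cvg_fsum _ _ (fun t s => cmod (x t s - f s) ^+ 2)) => // s.
  rewrite -[X in _ --> X](mulr0 (0 : R)); under eq_fun do rewrite expr2.
  by apply: cvgM; exact: coord_cvg.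
near=> t; rewrite ger0_norm ?nsq_ge0//.
have Px : (wpen p w (x t) <= (Pf + h)%:E)%E.
  near: t; have [N _ xN] := eventually_near_min h0.
  by exists N => // t /= /xN[].
have Fx : `|\sum_(s \in F) wterm p w s (f s) -
    \sum_(s \in F) wterm p w s (x t s)| <= h.
  by near: t; move/cvgrPdist_le: wF => /(_ _ h0).
have Fsq : `|\sum_(s \in F) cmod (x t s - f s) ^+ 2| <= h.
  by near: t; move/cvgr0Pnorm_le: sqF => /(_ _ h0).
have tail (y : T -> R[i]) c :
    (\esum_(s in [set: T]) (wterm p w s (y s))%:E <= c%:E)%E ->
    c - \sum_(s \in F) wterm p w s (y s) <= 3 * h ->
    (\esum_(s in ~` F) (cmod (y s) ^+ 2)%:E <= (6 * k)%:E)%E.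
  move=> yc cF; apply: (@le_trans _ _ (sqbound w0 (3 * h))%:E);
    last by rewrite lee_fin.
  apply: (esum_sq_le hp w0_gt0 hw).
  apply: le_trans (esum_tail _ finF yc) _; last by rewrite lee_fin.
  by move=> s; exact: (wterm_ge0 p w0_gt0 hw).
have tail_x : (\esum_(s in ~` F) (cmod (x t s) ^+ 2)%:E <= (6 * k)%:E)%E.
  apply: (tail _ _ Px); move: Fx; rewrite ler_norml => /andP[_]; lra.
have tail_f : (\esum_(s in ~` F) (cmod (f s) ^+ 2)%:E <= (6 * k)%:E)%E.
  by apply: (tail _ Pf); [rewrite -/(wpen p w f) f_pen|lra].
rewrite -lee_fin -sqsum_fin /sqsum (esumID F); last first.
  by move=> s _; rewrite lee_fin sqr_ge0.
rewrite !setTI esum_fset//; last by move=> s _; rewrite lee_fin sqr_ge0.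
rewrite fsumEFin//.
apply: (@le_trans _ _ (h%:E + (2 * (6 * k) + 2 * (6 * k))%:E)%E).
  apply: leeD; first by rewrite lee_fin; exact: le_trans (ler_norm _) Fsq.
  apply: esum_leP => G finG GF.
  apply: (@le_trans _ _ (2 * (\sum_(s \in G) cmod (x t s) ^+ 2) +
                         2 * (\sum_(s \in G) cmod (f s) ^+ 2))).
    rewrite !mulr_fsumr -fsbig_split//=; apply: ler_fsum => // s _.
    by rewrite -cmod_parallelogram lerDr sqr_ge0.
  have le (y : T -> R[i]) :
      (\esum_(s in ~` F) (cmod (y s) ^+ 2)%:E <= (6 * k)%:E)%E ->
      \sum_(s \in G) cmod (y s) ^+ 2 <= 6 * k.
    by move=> yk; rewrite -lee_fin; exact: le_trans (fsum_le_esum _ finG GF) yk.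
  by rewrite lerD// ler_wpM2l// le.
rewrite -EFinD lee_fin; apply: le_trans ke; rewrite /h; lra.
Unshelve. all: by end_near. Qed.

End penalized_convergence.

(** * Unconditional sums and linearity of adjoints *)

#[local] Existing Instance summability.totally_filter.

Section unconditional_sums.
Variables (R : realType) (I : choiceType).

Lemma partial_sumE (W : zmodType) (x : I -> W) (B : {fset I}) :
  summability.partial_sum x B = \sum_(s \in [set` B]) x s.
Proof.
by rewrite fsbig_finite//= set_fsetK /summability.partial_sum big_seq_fsetE.
Qed.

(** The supremum of the finite partial sums is also their limit along the
    filter of finite sets, as these sums grow with the set. *)
Lemma nonneg_sum_cvg (a : I -> R) (r : R) : (forall s, 0 <= a s) ->
  \esum_(s in [set: I]) (a s)%:E = r%:E ->
  summability.partial_sum a @ summability.totally --> r.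
Proof.
move=> a0 ar; apply/cvgrPdist_le => e e0.
have [_ [F [finF _] <-]] : exists2 y, [set (\sum_(s \in A) (a s)%:E)%E
    | A in fsets [set: I]] y & ((r - e)%:E < y)%E.
  apply: ereal_sup_gt; change ((r - e)%:E < \esum_(s in [set: I]) (a s)%:E)%E.
  by rewrite ar lte_fin ltrBlDr ltrDl.
rewrite fsumEFin// lte_fin => Fr.
exists (fset_set F) => // B /= FB; rewrite partial_sumE.
have Br : \sum_(s \in [set` B]) a s <= r.
  by rewrite -lee_fin -ar; apply: fsum_le_esum => //; exact: finite_fset.
have FleB : \sum_(s \in F) a s <= \sum_(s \in [set` B]) a s.
  rewrite -lee_fin -!fsumEFin//.
  apply: lee_fsum_nneg_subset => //.
    move=> s; rewrite inE => Fs; rewrite inE /=; apply: (fsubsetP FB).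
    by rewrite in_fset_set// inE.
  by move=> s _; rewrite lee_fin.
by rewrite ger0_norm ?subr_ge0//; lra.
Qed.

(** Absolute summability implies unconditional convergence: the real and the
    imaginary part of z are differences of the nonnegative families |z|,
    |z| - Re z and |z| - Im z, all of them dominated by 2 |z|. *)
Lemma summable_sum_cvg (z : I -> R[i]) :
  (\esum_(s in [set: I]) (cmod (z s))%:E < +oo)%E ->
  summability.partial_sum (z : I -> R[i]^o) @ summability.totally -->
  summability.sum (z : I -> R[i]^o).
Proof.
move=> zoo.
have fin (a : I -> R) : (forall s, 0 <= a s <= 2 * cmod (z s)) ->
    exists r : R, summability.partial_sum a @ summability.totally --> r.
  move=> az; have a0 s : 0 <= a s by have /andP[] := az s.
  exists (fine (\esum_(s in [set: I]) (a s)%:E)); apply: nonneg_sum_cvg => //.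
  rewrite fineK// ge0_fin_numE; last by apply: esum_ge0 => s _; rewrite lee_fin.
  apply: (@le_lt_trans _ _
    (\esum_(s in [set: I]) ((cmod (z s))%:E + (cmod (z s))%:E))%E).
    apply: le_esum => s _; rewrite -EFinD lee_fin; have /andP[_] := az s; lra.
  by rewrite esumD ?lte_add_pinfty// => s _; rewrite lee_fin cmod_ge0.
have [|r1 r1P] := fin (fun s => cmod (z s)).
  by move=> s; have := cmod_ge0 (z s); lra.
have [|r2 r2P] := fin (fun s => cmod (z s) - complex.Re (z s)).
  move=> s; have := cmod_ge0 (z s); have := ler_Re_cmod (z s).
  by rewrite ler_norml; lra.
have [|r3 r3P] := fin (fun s => cmod (z s) - complex.Im (z s)).
  move=> s; have := cmod_ge0 (z s); have := ler_Im_cmod (z s).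
  by rewrite ler_norml; lra.
suff h : summability.partial_sum (z : I -> R[i]^o) @ summability.totally -->
    (((r1 - r2) +i* (r1 - r3))%C : R[i]^o).
  by rewrite /summability.sum; apply: cvgP h.
apply/cvgrPdist_le => e e0.
have eE : (complex.Re e)%:C%C = e by rewrite RRe_real// gtr0_real.
have e'0 : 0 < complex.Re e / 4 by rewrite divr_gt0// -ltcR eE.
near=> B.
have h1 : `|r1 - summability.partial_sum (fun s => cmod (z s)) B| <=
    complex.Re e / 4.
  by near: B; move/cvgrPdist_le: r1P => /(_ _ e'0).
have h2 : `|r2 - summability.partial_sum
    (fun s => cmod (z s) - complex.Re (z s)) B| <= complex.Re e / 4.
  by near: B; move/cvgrPdist_le: r2P => /(_ _ e'0).
have h3 : `|r3 - summability.partial_sum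
    (fun s => cmod (z s) - complex.Im (z s)) B| <= complex.Re e / 4.
  by near: B; move/cvgrPdist_le: r3P => /(_ _ e'0).
rewrite -eE -cmodE lecR; apply: le_trans (cmod_le_ReIm _) _.
have -> : summability.partial_sum (z : I -> R[i]^o) B =
   ((\sum_(i : B) complex.Re (z (val i))) +i*
    (\sum_(i : B) complex.Im (z (val i))))%C :> R[i].
  rewrite /summability.partial_sum; apply/eqP; rewrite eq_complex /=.
  rewrite (big_morph _ (@ReD R) (erefl _)).
  by rewrite (big_morph _ (@ImD R) (erefl _)) !eqxx.
move: h1 h2 h3; rewrite /summability.partial_sum !sumrB /=.
rewrite !ler_norml.
set S1 := \sum_(_ | _) _; set S2 := \sum_(_ | _) complex.Re _.
set S3 := \sum_(_ | _) complex.Im _ => /andP[? ?] /andP[? ?] /andP[? ?].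
rewrite [leRHS](_ : _ = complex.Re e / 2 + complex.Re e / 2); last by field.
by apply: lerD; rewrite ler_norml; apply/andP; split; lra.
Unshelve. all: by end_near. Qed.

End unconditional_sums.

Section adjoint.
Variables (R : realType) (L : countType).
Implicit Types a b c : l2 R L.

Lemma l2_inner_cvg a b :
  summability.partial_sum (fun l => a l * (b l)^* : R[i]^o)
    @ summability.totally --> (l2_inner a b : R[i]^o).
Proof.
apply: summable_sum_cvg.
apply: (@le_lt_trans _ _ (sqsum a + sqsum b)%E).
  rewrite /sqsum -esumD => [|s _|s _]; rewrite ?lee_fin ?sqr_ge0//.
  apply: le_esum => s _; rewrite -EFinD lee_fin cmodM.
  rewrite [cmod (_^*)]/cmod norm_conjC -/(cmod _).
  have := cmod_ge0 (a s); have := cmod_ge0 (b s); nra.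
by rewrite !sqsum_fin -EFinD ltry.
Qed.

Lemma l2_innerPr (k : R[i]) a b c :
  l2_inner a (k *: b + c) = k^* * l2_inner a b + l2_inner a c.
Proof.
apply: (@cvg_unique _ (@norm_hausdorff _ _) _ _ _ _
  (@l2_inner_cvg a (k *: b + c))).
have -> : summability.partial_sum (fun l => a l * ((k *: b + c) l)^* : R[i]^o) =
    fun B => k^* * summability.partial_sum (fun l => a l * (b l)^* : R[i]^o) B +
             summability.partial_sum (fun l => a l * (c l)^* : R[i]^o) B.
  apply/funext => B; rewrite /summability.partial_sum mulr_sumr -big_split.
  apply: eq_bigr => s _.
  by rewrite l2DE l2ZE rmorphD rmorphM/= mulrDr mulrCA.
apply: cvgD; last exact: l2_inner_cvg.
by apply: (@cvgM _ _ _ _ (fun=> k^*)); [exact: cvg_cst|exact: l2_inner_cvg].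
Qed.

(** The pairings of both sides with any vector of H agree; pairing with their
    difference shows that it vanishes. *)
Lemma adjoint_linear (H : hilbertType R) (F : H -> l2 R L) (Fs : l2 R L -> H)
    (k : R[i]) a b : is_adjoint F Fs ->
  Fs (k *: a + b) = k *: Fs a + Fs b.
Proof.
move=> adj; apply/eqP; rewrite -subr_eq0; apply/eqP.
set d := Fs _ - _; apply/normr0_eq0/eqP.
rewrite -sqrf_eq0 -inner_norm {2}/d linearBr /= linearPr /= -!adj l2_innerPr.
by rewrite subrr.
Qed.

End adjoint.

(** * Flattening the product of sequence spaces *)

Section flattening.
Variables (R : realType) (n : nat) (L : 'I_n -> countType).

Definition flat_index : countType := {i : 'I_n & L i}.

Lemma esum_flat_index (a : flat_index -> R) : (forall s, 0 <= a s) ->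
  \esum_(s in [set: flat_index]) (a s)%:E =
  (\sum_(i < n) \esum_(l in [set: L i]) (a (Tagged L l))%:E)%E.
Proof.
move=> a0.
transitivity (\esum_(s in [set: flat_index])
    (\sum_(i < n) if tag s == i then (a s)%:E else 0)%E).
  apply: eq_esum => s _; rewrite (bigD1 (tag s))//= eqxx big1 ?adde0// => i.
  by rewrite eq_sym => /negbTE->.
rewrite esum_sum => [|s i _ _]; last by case: ifP; rewrite ?lee_fin.
apply: eq_bigr => i _.
have inj : set_inj [set: L i] (fun l => Tagged L l : flat_index).
  by move=> l l' _ _ /eqP; rewrite eq_Tagged => /eqP.
rewrite -(@esum_image _ _ _ setT (fun l => Tagged L l : flat_index)
  (fun s => (a s)%:E))// [RHS]esum_mkcond.
apply: eq_esum => -[j l] _ /=; case: eqP => [ji|ji].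
  by case: _ / ji l => l; rewrite mem_set//; exists l.
rewrite memNset// => -[l' _ /(congr1 tag)/=].
by move/esym.
Qed.

Lemma flatten_subproof (f : l2n R L) :
  (fun s : flat_index => f (tag s) (tagged s)) \in @l2_pred R flat_index.
Proof.
rewrite inE /= /sqsum esum_flat_index => [|s]; last exact: sqr_ge0.
rewrite (eq_bigr (fun i => (nsq (f i))%:E)) => [|i _].
  by rewrite sumEFin ltry.
exact: (sqsum_fin (f i)).
Qed.

Definition flatten (f : l2n R L) : l2 R flat_index := L2 (flatten_subproof f).

Lemma unflatten_subproof (x : l2 R flat_index) i :
  (fun l : L i => x (Tagged L l)) \in @l2_pred R (L i).
Proof.
rewrite inE /= /sqsum; apply: le_lt_trans (ltry (nsq x)).
rewrite -sqsum_fin /sqsum esum_flat_index => [|s]; last exact: sqr_ge0.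
rewrite (bigD1 i)//= leeDl// sume_ge0// => j _.
by apply: esum_ge0 => s _; rewrite lee_fin sqr_ge0.
Qed.

Definition unflatten (x : l2 R flat_index) : l2n R L :=
  fun i => L2 (unflatten_subproof x i).

Lemma flattenK f : unflatten (flatten f) = f.
Proof. by apply: functional_extensionality_dep => i; apply: l2_eqP. Qed.

Lemma unflattenK x : flatten (unflatten x) = x.
Proof. by apply: l2_eqP => -[i l]. Qed.

Lemma flatten_sub f h : flatten (l2n_sub f h) = flatten f - flatten h.
Proof. exact: l2_eqP. Qed.

Lemma unflattenP (k : R[i]) x y i :
  unflatten (k *: x + y) i = k *: unflatten x i + unflatten y i.
Proof. exact: l2_eqP. Qed.

Lemma l2n_normE f : l2n_norm f = Num.sqrt (nsq (flatten f)).
Proof.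
rewrite /l2n_norm; congr Num.sqrt; apply: EFin_inj.
rewrite -sqsum_fin /sqsum esum_flat_index => [|s]; last exact: sqr_ge0.
rewrite -sumEFin; apply: eq_bigr => i _.
by rewrite -/(nsq (f i)) -sqsum_fin.
Qed.

Lemma penalty_flatten (p w : 'I_n -> R) (f : l2n R L) : (forall i, 0 < w i) ->
  penalty p w (fun=> 1) f =
  wpen (fun s : flat_index => p (tag s)) (fun s => w (tag s)) (flatten f).
Proof.
move=> w0; rewrite /wpen esum_flat_index => [|s].
  by apply: eq_bigr => i _; rewrite mul1e.
by rewrite /wterm mulr_ge0 ?powR_ge0// ltW.
Qed.

End flattening.

Section frame_synthesis.
Variables (R : realType) (H H' : hilbertType R) (n : nat)
  (L : 'I_n -> countType) (F : forall i : 'I_n, H -> l2 R (L i))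
  (Fs : forall i : 'I_n, l2 R (L i) -> H)
  (hFs : forall i : 'I_n, is_adjoint (@F i) (@Fs i)) (A : {linear H -> H'}).

Definition flatKA (x : l2 R (flat_index L)) : H' := KA A Fs (unflatten x).

Lemma flatKA_linear : linear flatKA.
Proof.
move=> k x y; rewrite /flatKA /KA scaler_sumr -big_split/=.
apply: eq_bigr => i _.
by rewrite unflattenP (adjoint_linear _ _ _ (@hFs i)) linearP.
Qed.

Definition flat_operator : {linear l2 R (flat_index L) -> H'} :=
  HB.pack flatKA (GRing.isLinear.Build R[i] (l2 R (flat_index L)) H' *:%R
    flatKA flatKA_linear).

(** Scaling by any e > nsq x, and not by nsq x itself, covers the case where x
    is 0. *)
Lemma flat_operator_contraction x : (opnorm (KA A Fs) < 1)%E ->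
  rnorm (flat_operator x) ^+ 2 <= nsq x.
Proof.
move=> K1.
have unit y : nsq y <= 1 -> rnorm (flat_operator y) <= 1.
  move=> y1; rewrite -lee_fin; apply: le_trans (ltW K1).
  apply: ereal_sup_ubound; exists (unflatten y) => //=.
  by rewrite l2n_normE unflattenK -sqrtr1 ler_sqrt.
suff h (e : R) : 0 < e -> nsq x <= e -> rnorm (flat_operator x) ^+ 2 <= e.
  apply/ler_addgt0Pr => e e0; apply: h; last by rewrite lerDl ltW.
  by rewrite ltr_wpDl ?nsq_ge0.
move=> e0 xe; have r0 : 0 < Num.sqrt e by rewrite sqrtr_gt0.
have := unit ((Num.sqrt e)^-1%:C%C *: x); rewrite linearZ /= rnormZ nsqZ.
rewrite cmod_real ger0_norm ?invr_ge0 ?(ltW r0)// exprVn sqr_sqrtr ?(ltW e0)//.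
rewrite !ler_pdivrMl// !mulr1 => /(_ xe).
by rewrite -{2}(sqr_sqrtr (ltW e0)) ler_sqr ?nnegrE ?rnorm_ge0 ?(ltW r0).
Qed.

End frame_synthesis.

(** * Energy estimates *)

Section energy.
Variables (R : realType) (n : nat) (L : 'I_n -> countType).
Variables (p w : 'I_n -> R) (hw : forall i, 0 < w i).
Implicit Types (f h : l2n R L) (alpha : 'I_n -> R).

Definition rwpsum f i : R := fine (wpsum (p i) (w i) (f i)).

Definition fin_pen f := forall i, wpsum (p i) (w i) (f i) \is a fin_num.

Lemma wpsum_ge0 f i : (0 <= wpsum (p i) (w i) (f i))%E.
Proof.
by apply: esum_ge0 => l _; rewrite lee_fin mulr_ge0 ?powR_ge0// ltW.
Qed.

Lemma rwpsum_ge0 f i : 0 <= rwpsum f i.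
Proof. by apply: fine_ge0; exact: wpsum_ge0. Qed.

Lemma penaltyE alpha f : fin_pen f ->
  penalty p w alpha f = (\sum_(i < n) alpha i * rwpsum f i)%:E.
Proof.
move=> ff; rewrite -sumEFin; apply: eq_bigr => i _.
by rewrite EFinM /rwpsum fineK.
Qed.

(** A product of +oo with a nonzero weight is infinite, whatever the sign of the
    weight, and a finite sum is finite only if its terms are. *)
Lemma penalty_fin_pen alpha f : (forall i, alpha i != 0) ->
  penalty p w alpha f \is a fin_num -> fin_pen f.
Proof.
move=> a0 /sum_fin_numP af i.
have := af i (mem_index_enum _) isT; have := wpsum_ge0 f i.
case: (wpsum _ _ _) => [r| |]//= _.
rewrite fin_numE; case: (ltgtP (alpha i) 0) (a0 i) => // ai _.
  by rewrite lt0_muley ?lte_fin// eqxx.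
by rewrite gt0_muley ?lte_fin// eqxx andbF.
Qed.

Variables (V : hilbertType R) (K : l2n R L -> V).

Lemma minimizer_energy alpha (g : V) f h : (forall i, alpha i != 0) ->
  minimizes (Phi K p w alpha g) setT f -> fin_pen h ->
  fin_pen f /\
  rnorm (g - K f) ^+ 2 + \sum_(i < n) alpha i * rwpsum f i <=
  rnorm (g - K h) ^+ 2 + \sum_(i < n) alpha i * rwpsum h i.
Proof.
move=> a0 [_ ffin fmin] hh.
have ff : fin_pen f.
  by apply: penalty_fin_pen a0 _; move: ffin; rewrite /Phi fin_numD => /andP[].
by split => //; have := fmin h I; rewrite /Phi !penaltyE// -!EFinD lee_fin.
Qed.

(** With negative weights every term of the penalty is nonpositive, so that the
    minimum m of the functional is at most |g - K h|^2 + alpha_i |h^i| for each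
    i, which bounds |h^i| from above for every h. *)
Lemma negative_weights_bound alpha (g : V) f : (forall i, alpha i < 0) ->
  minimizes (Phi K p w alpha g) setT f ->
  exists C M : R, 0 <= C /\ forall h,
    (penalty p w (fun=> 1%R) h <= (C * (rnorm (g - K h) ^+ 2 + M))%:E)%E.
Proof.
move=> a0 [_ ffin fmin].
set m := fine (Phi K p w alpha g f).
exists (\sum_(i < n) (- alpha i)^-1), (- m); split.
  by apply: sumr_ge0 => i _; rewrite invr_ge0 oppr_ge0 ltW.
move=> h; rewrite mulr_suml -sumEFin; apply: lee_sum => i _; rewrite mul1e.
have : (m%:E <= (rnorm (g - K h) ^+ 2)%:E +
                (alpha i)%:E * wpsum (p i) (w i) (h i))%E.
  rewrite /m fineK//; apply: le_trans (fmin h I) _; rewrite /Phi leeD2l//.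
  rewrite /penalty (bigD1 i)//= -[leRHS]adde0 leeD2l//.
  apply: sume_le0 => j _; rewrite mule_le0_ge0 ?lee_fin ?(ltW (a0 j))//.
  exact: wpsum_ge0.
have := wpsum_ge0 h i; have := a0 i.
case: (wpsum _ _ _) => [r| |]//= ai _; last first.
  by rewrite lt0_muley ?lte_fin// addeNy.
rewrite -EFinM -EFinD !lee_fin => mr.
by rewrite ler_pdivlMl ?oppr_gt0//; lra.
Qed.

End energy.

Section bounded_below.
Variables (R : realType) (T : countType) (p w : T -> R) (w0 : R).
Hypotheses (hp : forall s, 1 <= p s <= 2) (w0_gt0 : 0 < w0)
  (hw : forall s, w0 <= w s).
Variables (V : normedModType R[i]) (K : {linear l2 R T -> V}).

(** The penalty controls the norm, so that a penalty dominated by the residual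
    makes the preimage of the unit ball under K bounded; homogeneity of K gives
    the other radii. *)
Lemma bounded_below (C M : R) (g : V) : 0 <= C ->
  (forall x, (wpen p w x <= (C * (rnorm (g - K x) ^+ 2 + M))%:E)%E) ->
  exists B, forall d x, 0 < d -> rnorm (K x) <= d -> nsq x <= B * d ^+ 2.
Proof.
move=> C0 CM; pose c := C * ((rnorm g + 1) ^+ 2 + M); exists (sqbound w0 c).
move=> d x d0 xd.
suff : nsq (d^-1%:C%C *: x) <= sqbound w0 c.
  rewrite nsqZ cmod_real ger0_norm ?invr_ge0 ?(ltW d0)// exprVn.
  by rewrite ler_pdivrMl ?exprn_gt0// mulrC.
apply: (nsq_le_pen hp w0_gt0 hw); apply: le_trans (CM _) _; rewrite lee_fin.
rewrite ler_wpM2l// lerD2r ler_sqr ?nnegrE ?rnorm_ge0 ?addr_ge0 ?rnorm_ge0//.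
apply: le_trans (rnormB _ _) _; rewrite lerD2l linearZ/= rnormZ.
by rewrite cmod_real ger0_norm ?invr_ge0 ?(ltW d0)// ler_pdivrMl// mulr1.
Qed.

End bounded_below.

(** * The regularization theorem *)

Lemma cvg_sumr0 (R : realType) (n : nat) (u : nat -> 'I_n -> R) :
  (forall i, (fun t => u t i) @ \oo --> (0 : R)) ->
  (fun t => \sum_(i < n) u t i) @ \oo --> (0 : R).
Proof.
move=> u0; rewrite [X in _ --> X](_ : 0 = \sum_(i < n) (0 : R));
  last by rewrite big1.
exact: (@cvg_seq_sum _ _ (index_enum 'I_n) u (fun=> 0)).
Qed.

Section weights.
Variables (R : realType) (n : nat) (a : nat -> 'I_n -> R).
Hypothesis ratio : forall i j, (fun t => a t i / a t j) @ \oo --> (1 : R).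

Lemma ratio_gt0 : \forall t \near \oo, forall i j, 0 < a t i / a t j.
Proof.
apply: filter_forall => i; apply: filter_forall => j.
have [N _ h] := (cvgrPdist_lt _ _).1 (ratio i j) _ ltr01.
exists N => // t /= /h; rewrite ltr_norml => /andP[_]; lra.
Qed.

Lemma weights_neq0 : \forall t \near \oo, forall i, a t i != 0.
Proof.
near=> t => i.
have : forall i j, 0 < a t i / a t j by near: t; exact: ratio_gt0.
by move=> /(_ i i); apply: contraTneq => ->; rewrite mul0r ltxx.
Unshelve. all: by end_near. Qed.

(** Ratios close to 1 are positive, so that at each large t the signs agree; if
    they are never all negative, they are all positive from some t on. *)
Lemma weights_sign :
  (exists t, forall i, a t i < 0) \/ \forall t \near \oo, forall i, 0 < a t i.
Proof.
have [neg|pos] := pselect (exists t, forall i, a t i < 0); [by left|right].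
near=> t => i; have at0 : forall i, a t i != 0 by near: t; exact: weights_neq0.
have rt : forall i j, 0 < a t i / a t j by near: t; exact: ratio_gt0.
case: (ltgtP (a t i) 0) (at0 i) => // ai _; case: pos; exists t => j.
by have := rt j i; rewrite ltr_ndivlMr// mul0r.
Unshelve. all: by end_near. Qed.

End weights.

Theorem theorem3p9 (R : realType) (H H' : hilbertType R)
  (n : nat) (L : 'I_n -> countType)
  (phi : forall i : 'I_n, L i -> H)
  (hphi : forall i : 'I_n, is_frame (phi i))
  (Fs : forall i : 'I_n, l2 R (L i) -> H)
  (hFs : forall i : 'I_n, is_adjoint (frame_operator (hphi i)) (Fs i))
  (A : {linear H -> H'}) (hA : bounded_operator A)
  (hK : (opnorm (KA A Fs) < 1%:E)%E)
  (p w : 'I_n -> R)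
  (hp : forall i, 1 <= p i <= 2)
  (hw : forall i, 0 < w i)
  (hpK : (exists j, 1 < p j) \/
         [set v | KA A Fs v = 0] = [set @l2n_zero R n L])
  (f0 : l2n R L) (eps : nat -> R) (g : nat -> H')
  (heps : forall t, 0 < eps t)
  (heps0 : eps @ \oo --> (0 : R))
  (hg : forall t, rnorm (g t - KA A Fs f0) <= eps t)
  (alpha : R -> 'I_n -> R)
  (halpha0 : forall i, (fun t => alpha (eps t) i) @ \oo --> (0 : R))
  (halpha1 : forall i, (fun t => eps t ^+ 2 / alpha (eps t) i) @ \oo --> (0 : R))
  (halpha2 : forall i j,
     (fun t => alpha (eps t) i / alpha (eps t) j) @ \oo --> (1 : R))
  (fstar : nat -> l2n R L)
  (hfstar : forall t,
     minimizes (Phi (KA A Fs) p w (alpha (eps t)) (g t)) setT (fstar t))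
  (fdag : l2n R L)
  (hfdag : unique_minimizer (penalty p w (fun=> 1))
     [set f | KA A Fs f = KA A Fs f0] fdag) :
  (fun t => l2n_norm (l2n_sub (fstar t) fdag)) @ \oo --> (0 : R).
Proof.
pose K := flat_operator hFs A.
have KE x : K (flatten x) = KA A Fs x by rewrite /K /= /flatKA flattenK.
pose f := flatten fdag; pose x t := flatten (fstar t).
suff nx : (fun t => nsq (x t - f)) @ \oo --> (0 : R).
  apply/cvg0P => e e0; have e2 : 0 < e ^+ 2 by rewrite exprn_gt0.
  have [N xN] := (cvg0P _).1 nx _ e2; exists N => t Nt.
  rewrite l2n_normE flatten_sub ger0_norm ?sqrtr_ge0//.
  rewrite -[leRHS]ger0_norm ?(ltW e0)// -sqrtr_sqr ler_sqrt ?(ltW e2)//.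
  exact: le_trans (ler_norm _) (xN _ Nt).
(* A reference index i0 exists unless n = 0, when the space is trivial. *)
have [[i0 _]|n0] := pselect (exists i : 'I_n, True); last first.
  have -> : (fun t => nsq (x t - f)) = fun=> 0; last exact: cvg_cst.
  apply/funext => t; have -> : x t - f = 0; last first.
    apply: EFin_inj; rewrite -sqsum_fin /sqsum esum1// => s _.
    by case: n0; exists (tag s).
  by apply: l2_eqP => s; case: n0; exists (tag s).
have [w0 w0_gt0 w0w] : exists2 w0, 0 < w0 & forall i, w0 <= w i.
  have s0 : 0 <= \sum_(i < n) (w i)^-1.
    by apply: sumr_ge0 => i _; rewrite invr_ge0 ltW.
  exists (1 + \sum_(i < n) (w i)^-1)^-1; first by rewrite invr_gt0 ltr_pwDl.
  move=> i; rewrite -[leRHS]invrK lef_pV2 ?posrE ?invr_gt0 ?ltr_pwDl//.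
  rewrite (bigD1 i)//= addrCA lerDl addr_ge0// sumr_ge0// => j _.
  by rewrite invr_ge0 ltW.
pose p' (s : flat_index L) := p (tag s).
pose w' (s : flat_index L) := w (tag s).
have hp' s : 1 <= p' s <= 2 by exact: hp.
have hw' s : w0 <= w' s by exact: w0w.
have PE h : penalty p w (fun=> 1) h = wpen p' w' (flatten h).
  exact: penalty_flatten.
have [[Kfdag fdag_fin fdag_min] fdag_uniq] := hfdag.
have dfin : fin_pen p w fdag.
  by apply: (penalty_fin_pen hw _ fdag_fin) => i; exact: oner_neq0.
pose Pf := \sum_(i < n) rwpsum p w fdag i.
have fPf : wpen p' w' f = Pf%:E.
  by rewrite -PE penaltyE//; under eq_bigr do rewrite mul1r.
have an0 : \forall t \near \oo, forall i, alpha (eps t) i != 0.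
  exact: (weights_neq0 (a := fun t => alpha (eps t))).
have gf t : rnorm (g t - KA A Fs fdag) <= eps t by rewrite Kfdag.
pose W t (h : l2n R L) := \sum_(i < n) alpha (eps t) i * rwpsum p w h i.
have energy : \forall t \near \oo, fin_pen p w (fstar t) /\
    rnorm (g t - K (x t)) ^+ 2 + W t (fstar t) <=
    eps t ^+ 2 + W t fdag.
  near=> t; have at0 : forall i, alpha (eps t) i != 0 by near: t.
  have [ff fle] := minimizer_energy hw at0 (hfstar t) dfin.
  split=> //; rewrite KE; apply: le_trans fle _; rewrite lerD2r.
  by rewrite ler_sqr ?nnegrE ?rnorm_ge0 ?(ltW (heps t)).
have eps2 : (fun t => eps t ^+ 2) @ \oo --> (0 : R).
  rewrite -[X in _ --> X](mulr0 (0 : R)); under eq_fun do rewrite expr2.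
  exact: cvgM.
have residual (V : nat -> R) : V @ \oo --> (0 : R) ->
    (\forall t \near \oo, rnorm (g t - K (x t)) ^+ 2 <= V t) ->
    (fun t => rnorm (K (x t) - K f)) @ \oo --> (0 : R).
  move=> V0 rV; apply/cvgr0Pnorm_le => e e0.
  have e2 : 0 < e / 2 by rewrite divr_gt0.
  have e4 : 0 < (e / 2) ^+ 2 by rewrite exprn_gt0.
  near=> t; rewrite ger0_norm ?rnorm_ge0//.
  have -> : K (x t) - K f = (g t - K f) - (g t - K (x t)).
    by rewrite opprB [RHS]addrC addrA subrK.
  apply: le_trans (rnormB _ _) _; rewrite [e]splitr; apply: lerD.
    rewrite KE; apply: le_trans (gf t) _; apply: le_trans (ler_norm _) _.
    near: t.
    by have [N hN] := (cvg0P _).1 heps0 _ e2; exists N.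
  rewrite -ler_sqr ?nnegrE ?rnorm_ge0 ?(ltW e2)//.
  apply: (@le_trans _ _ (V t)); first by near: t.
  apply: le_trans (ler_norm _) _; near: t.
  by have [N hN] := (cvg0P _).1 V0 _ e4; exists N.
have [[t0 neg]|pos] := weights_sign (a := fun t => alpha (eps t)) halpha2.
- have [C [M [C0 CM]]] := negative_weights_bound hw neg (hfstar t0).
  (* At t0 the penalty is at most C (|g t0 - K y|^2 + M) for every y. In the
     energy inequality at t the penalty of x t is therefore at most a constant
     plus 2 C times the squared residual, and the small factor a t lets the
     left-hand side absorb it. *)
  have CMx (y : l2 R (flat_index L)) :
      (wpen p' w' y <= (C * (rnorm (g t0 - K y) ^+ 2 + M))%:E)%E.
    by rewrite -(unflattenK y) -PE KE.
  have [B Bbd] := bounded_below hp' w0_gt0 hw' C0 CMx.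
  pose a t := \sum_(i < n) `|alpha (eps t) i|; pose D := 1 + eps t0.
  have a_cvg : a @ \oo --> (0 : R).
    apply: cvg_sumr0 => i; rewrite -[X in _ --> X](normr0 R).
    exact: cvg_norm.
  pose V t := 2 * eps t ^+ 2 + 2 * (a t * (Pf + C * (2 * D ^+ 2 + M))).
  have V_cvg : V @ \oo --> (0 : R).
    rewrite [X in _ --> X](_ : 0 =
        2 * 0 + 2 * (0 * (Pf + C * (2 * D ^+ 2 + M)))).
      by apply: cvgD; apply: cvgM => //; [exact: cvg_cst..|];
        apply: cvgM => //; exact: cvg_cst.
    by rewrite mul0r !mulr0 addr0.
  have Kx : (fun t => rnorm (K (x t) - K f)) @ \oo --> (0 : R).
    have c0 : 0 < (4 * C + 1)^-1 by rewrite invr_gt0 ltr_wpDl ?mulr_ge0.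
    apply: (residual V V_cvg); near=> t.
    have [ft et] : fin_pen p w (fstar t) /\
      rnorm (g t - K (x t)) ^+ 2 + W t (fstar t) <=
      eps t ^+ 2 + W t fdag by near: t.
    set r := rnorm (g t - K (x t)) in et *.
    have eps1 : eps t <= 1.
      apply: le_trans (ler_norm _) _; near: t.
      by have [N hN] := (cvg0P _).1 heps0 _ ltr01; exists N.
    (* This makes the absorbed part at most half of r ^+ 2; the summand 1 keeps
       the factor positive when C = 0. *)
    have aC : a t * (4 * C + 1) <= 1.
      rewrite -ler_pdivlMr ?ltr_wpDl ?mulr_ge0// mul1r.
      apply: le_trans (ler_norm _) _; near: t.
      by have [N hN] := (cvg0P _).1 a_cvg _ c0; exists N.
    have a_ge0 : 0 <= a t by apply: sumr_ge0.
    have Q_le : \sum_(i < n) rwpsum p w (fstar t) i <=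
        C * (2 * D ^+ 2 + 2 * r ^+ 2 + M).
      have := CM (fstar t); rewrite penaltyE// lee_fin.
      under eq_bigr do rewrite mul1r.
      move/le_trans; apply; rewrite ler_wpM2l// lerD2r.
      have gg : rnorm (g t0 - KA A Fs (fstar t)) <= D + r.
        have -> : g t0 - KA A Fs (fstar t) =
          ((g t0 - KA A Fs f0) - (g t - KA A Fs f0)) + (g t - K (x t)).
          by rewrite KE opprB addrA [_ + (KA A Fs f0 - _)]addrA subrK subrK.
        apply: le_trans (rnormD _ _) _; rewrite lerD2r.
        apply: le_trans (rnormB _ _) _; rewrite addrC.
        by apply: lerD => //; exact: le_trans (hg t) eps1.
      have r_ge0 := rnorm_ge0 (g t - K (x t)); rewrite -/r in r_ge0.
      have D0 : 0 < D by rewrite addr_gt0.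
      apply: (@le_trans _ _ ((D + r) ^+ 2)).
        by rewrite ler_sqr ?nnegrE ?rnorm_ge0 ?(addr_ge0 (ltW D0) r_ge0).
      rewrite -subr_ge0 (_ : _ - _ = (D - r) ^+ 2) ?sqr_ge0//.
      by ring.
    have cross : W t fdag -
        W t (fstar t) <=
        a t * (Pf + \sum_(i < n) rwpsum p w (fstar t) i).
      rewrite /Pf /W -big_split/= mulr_sumr -sumrB; apply: ler_sum => i _.
      have := rwpsum_ge0 p hw fdag i; have := rwpsum_ge0 p hw (fstar t) i.
      have : `|alpha (eps t) i| <= a t.
        by rewrite /a (bigD1 i)//= lerDl sumr_ge0.
      rewrite -mulrBr; move: (rwpsum _ _ _ _) (rwpsum _ _ _ _) => u v au u0 v0.
      apply: le_trans (ler_norm _) _; rewrite normrM; apply: ler_pM => //.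
      by apply: le_trans (ler_normB _ _) _; rewrite !ger0_norm.
    have aQ := ler_wpM2l a_ge0 Q_le.
    have r2 : 0 <= r ^+ 2 by exact: sqr_ge0.
    rewrite /V; nra.
  apply/cvg0P => e e0; pose d := Num.sqrt (e / (`|B| + 1)).
  have B1 : 0 < `|B| + 1 by rewrite ltr_wpDl.
  have d0 : 0 < d by rewrite sqrtr_gt0 divr_gt0.
  have [N KN] := (cvg0P _).1 Kx _ d0; exists N => t Nt.
  rewrite ger0_norm ?nsq_ge0//.
  have Kd : rnorm (K (x t - f)) <= d.
    by rewrite linearB; exact: le_trans (ler_norm _) (KN _ Nt).
  apply: le_trans (Bbd _ _ d0 Kd) _.
  rewrite sqr_sqrtr ?divr_ge0 ?(ltW e0) ?(ltW B1)// mulrCA ler_piMr ?(ltW e0)//.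
  by rewrite ler_pdivrMr// mul1r; have := ler_norm B; lra.
have Kx : (fun t => rnorm (K (x t) - K f)) @ \oo --> (0 : R).
  apply: (residual (fun t => eps t ^+ 2 +
    W t fdag)).
    rewrite -[X in _ --> X](addr0 (0 : R)); apply: cvgD => //.
    apply: cvg_sumr0 => i; rewrite -[X in _ --> X](mul0r (rwpsum p w fdag i)).
    by apply: cvgM => //; exact: cvg_cst.
  near=> t; have at0 : forall i, 0 < alpha (eps t) i by near: t.
  have [_ et] : fin_pen p w (fstar t) /\
    rnorm (g t - K (x t)) ^+ 2 + W t (fstar t) <=
    eps t ^+ 2 + W t fdag by near: t.
  apply: le_trans et; rewrite lerDl; apply: sumr_ge0 => i _.
  by rewrite mulr_ge0 ?(ltW (at0 i))// rwpsum_ge0.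
(* Dividing the energy inequality by one of the weights turns the weighted
   penalties into the plain one, up to the factor Gm. *)
pose be t i := alpha (eps t) i / alpha (eps t) i0.
pose ga t i := alpha (eps t) i0 / alpha (eps t) i.
pose Gm t := 1 + \sum_(i < n) `|ga t i - 1|.
pose U t := Gm t *
  (eps t ^+ 2 / alpha (eps t) i0 + \sum_(i < n) be t i * rwpsum p w fdag i).
apply: (@penalized_cvg _ _ p' w' w0 hp' w0_gt0 hw' _ K _ f Pf fPf _ x U Kx).
- by move=> y; exact: flat_operator_contraction.
- move=> y Ky Py; have Jy : (penalty p w (fun=> 1%R) (unflatten y) <= Pf%:E)%E.
    by rewrite PE unflattenK.
  have Jge0 : (0 <= penalty p w (fun=> 1%R) (unflatten y))%E.
    by rewrite PE; apply: wpen_ge0 w0_gt0 hw' _.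
  rewrite -(unflattenK y) (fdag_uniq (unflatten y))//; split.
  + by rewrite /= -KE unflattenK Ky KE.
  + by rewrite ge0_fin_numE//; exact: le_lt_trans Jy (ltry _).
  + by move=> z /fdag_min; apply: le_trans; rewrite PE unflattenK PE fPf.
- near=> t; have at0 : forall i, 0 < alpha (eps t) i by near: t.
  have [ft et] : fin_pen p w (fstar t) /\
    rnorm (g t - K (x t)) ^+ 2 + W t (fstar t) <=
    eps t ^+ 2 + W t fdag by near: t.
  rewrite /x -PE penaltyE// lee_fin; under eq_bigr do rewrite mul1r.
  have ga_le i : ga t i <= Gm t.
    rewrite /Gm (bigD1 i)//= addrA -[leLHS]addr0; apply: lerD.
      by have := ler_norm (ga t i - 1); lra.
    exact: sumr_ge0.
  apply: (@le_trans _ _ (Gm t * \sum_(i < n) be t i * rwpsum p w (fstar t) i)).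
    rewrite mulr_sumr; apply: ler_sum => i _.
    rewrite mulrA ler_peMl ?rwpsum_ge0//.
    apply: (@le_trans _ _ (ga t i * be t i)); last first.
      by rewrite ler_wpM2r ?ga_le// /be divr_ge0 ?ltW.
    by rewrite /ga /be mulrA divfK ?divff// gt_eqF.
  rewrite /U ler_wpM2l ?addr_ge0 ?sumr_ge0//.
  have div h : \sum_(i < n) be t i * rwpsum p w h i =
      (W t h) / alpha (eps t) i0.
    by rewrite /W mulr_suml; apply: eq_bigr => i _; rewrite /be mulrAC.
  rewrite !div -mulrDl ler_pM2r ?invr_gt0//; apply: le_trans et.
  by rewrite lerDr sqr_ge0.
- have Gm_cvg : Gm @ \oo --> (1 : R).
    rewrite -[X in _ --> X](addr0 (1 : R)); apply: cvgD; first exact: cvg_cst.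
    apply: cvg_sumr0 => i; rewrite -[X in _ --> X](normr0 R); apply: cvg_norm.
    rewrite -[X in _ --> X](subrr (1 : R)); apply: cvgB; last exact: cvg_cst.
    exact: halpha2.
  rewrite -[X in _ --> X]mul1r; apply: cvgM => //.
  rewrite -[X in _ --> X]add0r; apply: cvgD; first exact: halpha1.
  apply: (@cvg_seq_sum _ _ (index_enum 'I_n)
    (fun t i => be t i * rwpsum p w fdag i) (rwpsum p w fdag)) => i.
  rewrite -[X in _ --> X]mul1r.
  by apply: cvgM; [exact: halpha2|exact: cvg_cst].
Unshelve. all: by end_near. Qed.
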